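(* Let $Y\simeq\mathbb{R}^N$ be a (finite dimensional) Hilbert space, $H:L^2(0,T)\to Y$ a linear and continuous operator with $H(L^2(0,T))=Y$, and $F:Y\to\mathbb{R}$ convex, continuously Fréchet-differentiable and norm-coercive on $Y$, i.e. $\|y\|_Y\to+\infty\Rightarrow F(y)\to+\infty$. Let $f(u)=F(Hu)$ and $H(\mathcal{L}):=\{Hu\;|\;u\in\mathcal{L}\}$. Then the problem $$\min_{u\in\mathrm{BV}(0,T)}\ f(u)+\mathrm{TGV}(u)$$ admits a solution $\bar u$ of the form $$\bar u(x)=\frac1\alpha\sum_{j=1}^{N_S}\bar\sigma_j^S\bar\lambda_j^SS_{\bar x_j^S}(x)+\frac1\beta\sum_{j=1}^{N_K}\bar\sigma_j^K\bar\lambda_j^KK_{\bar x_j^K}(x)+\bar ax+\bar b$$ for some finite sets $\{\bar x_j^S\}_{j=1}^{N_S},\{\bar x_j^K\}_{j=1}^{N_K}$ in $(0,T)$, $\bar\sigma_j^S,\bar\sigma_j^K\in\{-1,1\}$, $\bar\lambda_j^S,\bar\lambda_j^K\ge0$, $\bar a,\bar b\in\mathbb{R}$, with $N_K+N_S\le N-\dim(H(\mathcal{L}))$ and $$\mathrm{TGV}(\bar u)=\sum_{j=1}^{N_S}\bar\lambda_j^S+\sum_{j=1}^{N_K}\bar\lambda_j^K.$$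
   Context: $T>0$, $\alpha,\beta>0$ are fixed. $C_0(0,T)$ is the space of continuous functions on $(0,T)$ vanishing at the boundary, with uniform norm $\|\cdot\|_C$; $M(0,T)=C_0(0,T)^*$ is the space of Radon measures with dual norm $\|\cdot\|_M$. $\mathrm{BV}(0,T)$ is the space of $u\in L^1(0,T)$ with distributional derivative $Du\in M(0,T)$. For $u\in\mathrm{BV}(0,T)$, $$\mathrm{TGV}(u)=\sup\left\{\int_0^T u\,v''\;\middle|\;v\in C_c^\infty(0,T),\ \|v\|_C\le\alpha,\ \|v'\|_C\le\beta\right\}=\inf_{w\in\mathrm{BV}(0,T)}\alpha\|Du-w\|_M+\beta\|Dw\|_M,$$ where $w$ is identified with the measure $w\,dx$. $\mathcal{L}$ is the space of affine functions $x\mapsto cx+d$ on $(0,T)$. $S_{x_0}=1_{(x_0,T)}$, and $K_{x_1}(x)=1_{(0,x_1)}(x)(x_1-x)$ if $x_1<T/2$, $K_{x_1}(x)=1_{(x_1,T)}(x)(x-x_1)$ if $x_1\ge T/2$. *)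

(* Defs.v *)
(* MathComp / MathComp-Analysis *)
From HB Require Import structures.
From mathcomp Require Import all_boot all_order all_algebra sesquilinear.
From mathcomp Require Import all_classical all_reals all_analysis.

Set Implicit Arguments.
Unset Strict Implicit.
Unset Printing Implicit Defensive.

Import Order.TTheory GRing.Theory Num.Theory.
Import numFieldNormedType.Exports.

Local Open Scope classical_set_scope.
Local Open Scope ring_scope.

(* Finite-dimensional normed spaces; a finite-dimensional Hilbert space is such
   a space whose norm comes from an inner product. *)
#[short(type="normedVectType")]
HB.structure Definition NormedVector (R : numFieldType) :=
  {V of NormedModule R V & Vector R V}.

Section FunctionSpaces.
Context {R : realType} (T : R).
Implicit Types (u v w phi : R -> R).

Definition lebesgue0T :=
  mrestr (@lebesgue_measure R) (measurable_itv `]0%R, T[).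
HB.instance Definition _ := Measure.on lebesgue0T.

(* Functions on (0,T) are represented by functions on the whole line; elements
   of L^2(0,T) are not quotiented by almost everywhere equality. Since BV(0,T)
   embeds into L^2(0,T) in dimension one, the elements of BV(0,T) are exactly
   the u : L2 such that BV u (defined below). *)
Definition L2 := LfunType lebesgue0T (lee1n 2).

Definition L2norm (u : R -> R) : \bar R := 'N[lebesgue0T]_2%:E[EFin \o u]%E.

Definition unorm phi : \bar R := ereal_sup [set `|phi x|%:E | x in `]0, T[].

(* C_0(0,T), each function being extended by 0 outside of (0,T). *)
Definition C0 : set (R -> R) :=
  [set phi | continuous phi /\ forall x, x \notin `]0, T[ -> phi x = 0].

Definition Ccinfty : set (R -> R) :=
  [set v | [/\ forall n x, derivable (v^`(n))%classic x 1,
               compact (closure [set x | v x != 0]) &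
               closure [set x | v x != 0] `<=` `]0, T[]].

(* M(0,T) = C_0(0,T)^*; the values of a functional off C0 are irrelevant. *)
Definition mnorm (mu : (R -> R) -> R) : \bar R :=
  ereal_sup [set `|mu phi|%:E | phi in C0 `&` [set phi | (unorm phi <= 1)%E]].

Definition radon (mu : (R -> R) -> R) : Prop :=
  (forall (a : R) phi psi, C0 phi -> C0 psi ->
     mu (a *: phi + psi) = a * mu phi + mu psi) /\ (mnorm mu < +oo)%E.

(* the measure w dx *)
Definition dens w : (R -> R) -> R :=
  fun phi => \int[lebesgue_measure]_(x in `]0, T[) (w x * phi x).

(* mu is the distributional derivative Du, as an element of M(0,T); it is
   determined by u on C0, where Ccinfty is dense. *)
Definition is_distr_deriv u (mu : (R -> R) -> R) : Prop :=
  radon mu /\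
  forall v, Ccinfty v ->
    mu v = - \int[lebesgue_measure]_(x in `]0, T[) (u x * v^`()%classic x).

Definition BV : set (R -> R) :=
  [set u | u \in Lfun lebesgue0T 1 /\ exists mu, is_distr_deriv u mu].

(* Infimal form of the second-order TGV; by duality it is the supremum of the
   integrals of u * v'' over v in Ccinfty with |v| <= beta and |v'| <= alpha. *)
Definition TGV (alpha beta : R) u : \bar R :=
  ereal_inf [set t | exists w Du Dw,
    [/\ BV w, is_distr_deriv u Du, is_distr_deriv w Dw &
        t = (alpha%:E * mnorm (fun phi => Du phi - dens w phi)%R
             + beta%:E * mnorm Dw)%E]].

Definition affine : set L2 :=
  [set u : L2 | exists c d : R, u = (fun x => c * x + d) %[ae lebesgue0T]].

Definition stepf (x0 : R) : R -> R := \1_`]x0, T[.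

Definition kink (x1 : R) : R -> R := fun x =>
  if x1 < T / 2 then \1_`]0, x1[ x * (x1 - x) else \1_`]x1, T[ x * (x - x1).

End FunctionSpaces.
Arguments affine {R} T.

Definition L2_continuous {R : realType} {T : R} {Y : normedModType R}
    (H : L2 T -> Y) : Prop :=
  forall (u : L2 T) (e : R), 0 < e -> exists2 d : R, 0 < d &
    forall v : L2 T, (L2norm T (v - u)%R < d%:E)%E -> `|H v - H u| < e.

(* Continuity of the derivative in the operator norm. *)
Definition continuously_differentiable {R : realType} {Y : normedModType R}
    (F : Y -> R) : Prop :=
  (forall y, differentiable F y) /\
  (forall y (e : R), 0 < e ->
     \forall z \near y, forall h, `|'d F z h - 'd F y h| <= e * `|h|).

Definition norm_coercive {R : realType} {Y : normedModType R}
    (F : Y -> R) : Prop :=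
  forall A : R, exists r : R, forall y, r <= `|y| -> A <= F y.

(* Main.v *)
(* Up to affine functions, u is a superposition of steps S_x against Du - w and of
   kinks K_x against Dw. So one first minimises F (sum_j l_j a_j + h) + sum_j |l_j|
   over combinations of finitely many atoms a_j = H S_x / alpha, H K_x / beta, with h
   in H(L). Conic Caratheodory modulo H(L) bounds the number of atoms by
   M = N - dim H(L); since the minimum over M + 1 atoms of each kind is attained
   (compactness), it is the minimum over all finite combinations.

   At the minimiser y, the optimality conditions say that q = - F'(y) vanishes on
   H(L), is bounded by 1 on the atoms and satisfies q y >= sum_j |l_j|. With
   V x = q (H S_x) and k x = q (H K_x), which lie in C_0 and satisfy |V| <= alpha,
   |k| <= beta and k' = - V, integration by parts gives
   q (H u) = Du V = (Du - w) V + Dw k <= alpha |Du - w|_M + beta |Dw|_M,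
   that is q (H u) <= TGV u. By convexity
   F (H u) + TGV u >= F y + q y >= F y + sum_j |l_j|, which proves both the
   optimality of the combination of atoms and the formula for its TGV.

   No regularity of V is used in the integration by parts: V is interpolated on
   uniform grids, which amounts to replacing u by its cell means. *)

(* The obstacle is that [Du] is prescribed on smooth test functions only, whereas V is merely
   continuous and u is an arbitrary function of BV. Both sides of q (H u) = Du V are therefore
   discretised on the same grid. If u_N is the step function of the cell means of u and V_N the
   nodal interpolant of V, then q (H u_N) = Du V_N holds exactly, by summation by parts. On the
   right V_N tends to V uniformly and [Du] is bounded. On the left u_N tends to u in L^2: Lebesgue
   differentiation gives convergence almost everywhere, and a bounded variation keeps the cell means
   bounded.

   In the same spirit k' = - V enters only through difference quotients of k over grid cells, so k
   is never differentiated.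

   V and k vanish outside (0, T) because steps and ramps placed there are affine on (0, T), and q
   annihilates affine functions. *)
Require Import Defs.
From mathcomp Require Import all_boot all_order all_algebra sesquilinear.
From mathcomp Require Import all_classical all_reals all_analysis.
From mathcomp Require Import measurable_realfun ring lra.

Set Implicit Arguments.
Unset Strict Implicit.
Unset Printing Implicit Defensive.

Import Order.TTheory GRing.Theory Num.Theory.
Import numFieldNormedType.Exports.

Local Open Scope classical_set_scope.
Local Open Scope ring_scope.

(** * A smooth ramp *)

Section SmoothRamp.
Context {R : realType}.
Implicit Types f g : R -> R.

(** The powers of 1/x make the family of flat exponentials closed under differentiation, up to
    linear combinations. *)
Definition expinv (k : nat) (x : R) : R :=
  if x <= 0 then 0 else x^-1 ^+ k * expR (- x^-1).

Lemma expinv_gt0 k x : 0 < x -> 0 < expinv k x.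
Proof.
move=> x0; rewrite /expinv (lt_geF x0) mulr_gt0 ?expR_gt0//.
by rewrite exprn_gt0// invr_gt0.
Qed.

Lemma expinv_le0 k x : x <= 0 -> expinv k x = 0.
Proof. by rewrite /expinv => ->. Qed.

Lemma expinv_ge0 k x : 0 <= expinv k x.
Proof.
by have [/expinv_le0->//|/(expinv_gt0 k)/ltW] := leP x 0.
Qed.

(** With y = 1/x, exp y is the power k + 1 of exp (y / (k + 1)), which is at least y / (k + 1). The
    difference quotient of [expinv k] at 0 is [expinv k.+1], so a linear bound for every [k] gives
    derivative 0 there. *)
Lemma expinv_le_linear k x : 0 <= x ->
  expinv k x <= k.+1%:R ^+ k.+1 * x.
Proof.
rewrite le_eqVlt => /predU1P[<-|x0]; first by rewrite expinv_le0// mulr0.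
rewrite /expinv (lt_geF x0).
have n0 : 0 < k.+1%:R :> R by [].
have h : (x^-1 / k.+1%:R) ^+ k.+1 <= expR (x^-1).
  rewrite [leRHS](_ : _ = expR (x^-1 / k.+1%:R) ^+ k.+1); last first.
    by rewrite -expRM_natl mulrC divfK ?gt_eqF.
  by rewrite lerXn2r ?nnegrE ?expR_ge0 ?divr_ge0 ?invr_ge0 ?(ltW x0)//
    (le_trans _ (expR_ge1Dx _))// lerDr.
rewrite expRN.
have e0 := expR_gt0 x^-1.
rewrite ler_pdivrMr//.
have -> : x^-1 ^+ k = k.+1%:R ^+ k.+1 * x * (x^-1 / k.+1%:R) ^+ k.+1.
  rewrite exprMn !exprVn [x ^+ k.+1]exprS.
  by field; rewrite !expf_neq0// ?gt_eqF//= expf_neq0// gt_eqF.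
by rewrite ler_pM2l// mulr_gt0// exprn_gt0.
Qed.

Lemma is_derive_expinv k (x : R) :
  is_derive x 1 (expinv k) (- k%:R * expinv k.+1 x + expinv k.+2 x).
Proof.
have [x0|x0|->] := ltgtP x 0.
- rewrite !expinv_le0 ?(ltW x0)// mulr0 addr0.
  apply: (@near_eq_is_derive _ _ _ (cst 0)).
    near=> y; rewrite expinv_le0//.
    by apply/ltW; near: y; exact: lt_nbhsl.
- apply: (@near_eq_is_derive _ _ _ (fun y : R => y^-1 ^+ k * expR (- y^-1))).
    near=> y; rewrite /expinv lt_geF//; near: y; exact: lt_nbhsr.
  have xn0 : x != 0 by rewrite gt_eqF.
  have dV : is_derive x (1 : R) (fun y : R => y^-1) (- x ^- 2).
    by apply: is_derive_eq; [exact: (@is_deriveV _ id)|rewrite /= scaler1].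
  have dX : is_derive x (1 : R) (fun y : R => y^-1 ^+ k)
      (k%:R * x^-1 ^+ k.-1 * (- x ^- 2)).
    rewrite (_ : (fun y : R => _) = (fun y : R => y^-1) ^+ k); last first.
      by apply/funext => y; rewrite exprfctE.
    apply: is_derive_eq.
    by rewrite /GRing.scale/= mulr_natl.
  have dE : is_derive x (1 : R) (fun y : R => expR (- y^-1))
      (expR (- x^-1) * x ^- 2).
    have dNV : is_derive x (1 : R) (fun y : R => - y^-1) (x ^- 2).
      by apply: is_derive_eq; rewrite opprK.
    exact: (is_derive1_comp (is_derive_expR _) dNV).
  apply: (is_derive_eq (is_deriveM dX dE)).
  rewrite /GRing.scale/= /expinv (lt_geF x0).
  case: k {dX} => [|k] /=.
    by rewrite !expr0 expr1 !mul0r; field.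
  rewrite -natr1 !exprS !exprVn; field.
  by rewrite xn0 expf_neq0.
- rewrite !expinv_le0// mulr0 addr0.
  suff h : h^-1 *: (expinv k (h *: 1 + 0) - expinv k 0) @[h --> 0^'] --> (0:R).
    apply: DeriveDef; first by apply/cvg_ex; exists 0; exact: h.
    exact: cvg_lim h.
  apply/cvgrPdist_le => e e0; near=> h.
  rewrite sub0r normrN addr0 /GRing.scale/= mulr1 (expinv_le0 k (lexx 0)) subr0.
  have hn0 : h != 0 by near: h; exact: nbhs_dnbhs_neq.
  have [h0|h0] := leP h 0; first by rewrite expinv_le0// mulr0 normr0 ltW.
  have -> : h^-1 * expinv k h = expinv k.+1 h.
    by rewrite /expinv (lt_geF h0) exprS mulrA.
  rewrite ger0_norm ?expinv_ge0//; apply: le_trans.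
    exact: expinv_le_linear (ltW h0).
  rewrite -ler_pdivlMl ?exprn_gt0//.
  have : `|h| <= (k.+2%:R ^+ k.+2)^-1 * e.
    near: h; apply: (@dnbhs0_le _ R).
    by rewrite mulr_gt0// invr_gt0 exprn_gt0.
  by rewrite gtr0_norm.
Unshelve. all: by end_near. Qed.

(* Closed under differentiation, hence made of smooth functions. *)
Inductive elementary : (R -> R) -> Prop :=
| elementary_cst c : elementary (fun _ => c)
| elementary_id : elementary id
| elementary_expinv k : elementary (expinv k)
| elementary_add f g :
    elementary f -> elementary g -> elementary (fun x => f x + g x)
| elementary_mul f g :
    elementary f -> elementary g -> elementary (fun x => f x * g x)
| elementary_inv f :
    elementary f -> (forall x, f x != 0) -> elementary (fun x => (f x)^-1)
| elementary_affine f a b :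
    elementary f -> elementary (fun x => f (a * x + b)).

Lemma is_derive_affine a b (x : R) : is_derive x 1 (fun y : R => a * y + b) a.
Proof.
have h : is_derive x 1 (fun y : R => a * y) a.
  apply: (is_derive_eq (is_deriveZ a (is_derive_id x 1))).
  by rewrite /GRing.scale/= mulr1.
by apply: (is_derive_eq (is_deriveD h (is_derive_cst b x 1))); rewrite addr0.
Qed.

Lemma elementary_derive f : elementary f ->
  exists2 f', elementary f' & forall x : R, is_derive x 1 f (f' x).
Proof.
elim=> {f} [c||k|f g ef [f' ef' df] eg [g' eg' dg]
  |f g ef [f' ef' df] eg [g' eg' dg]|f ef [f' ef' df] f0
  |f a b ef [f' ef' df]].
- exists (fun=> 0); first exact: elementary_cst.
  by move=> x; exact: is_derive_cst.
- exists (fun=> 1); first exact: elementary_cst.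
  by move=> x; exact: is_derive_id.
- exists (fun x => - k%:R * expinv k.+1 x + expinv k.+2 x).
    apply: elementary_add; last exact: elementary_expinv.
    by apply: elementary_mul; [exact: elementary_cst|exact: elementary_expinv].
  exact: is_derive_expinv.
- exists (fun x => f' x + g' x); first exact: elementary_add.
  by move=> x; exact: is_deriveD.
- exists (fun x => f x * g' x + g x * f' x).
    by apply: elementary_add; exact: elementary_mul.
  by move=> x; exact: is_deriveM.
- exists (fun x => -1 * ((f x)^-1 * (f x)^-1) * f' x).
    apply: elementary_mul => //; apply: elementary_mul;
      first exact: elementary_cst.
    by apply: elementary_mul; exact: elementary_inv.
  move=> x; apply: (is_derive_eq (is_deriveV (f0 x) (df x))).
  by rewrite /GRing.scale/= mulN1r expr2 invfM.
- exists (fun x => f' (a * x + b) * a).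
    by apply: elementary_mul; [exact: elementary_affine|exact: elementary_cst].
  move=> x; apply: (@is_derive1_comp _ f (fun y => a * y + b)) => //.
  exact: is_derive_affine.
Qed.

Lemma elementary_smooth f n (x : R) :
  elementary f -> derivable f^`(n)%classic x 1.
Proof.
move=> ef; suff : elementary f^`(n)%classic.
  by move=> /elementary_derive[f' _] /(_ x)[].
elim: n => [//|n /elementary_derive[f' ef' df]].
rewrite derive1nS (_ : _^`()%classic = f')//.
by apply/funext => y; rewrite derive1E; case: (df y).
Qed.

Lemma elementary_continuous f : elementary f -> continuous f.
Proof.
move=> /elementary_derive[f' _ df] x; apply: differentiable_continuous.
by apply/derivable1_diffP; case: (df x).
Qed.

(** The identity times the smooth transition [expinv 0 x / den x] from 0 to 1. The derivative is
    constant on each side of [0, 1] and bounded on it by compactness; the global bound [C] survives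
    rescaling and will provide domination. *)
Lemma smooth_ramp : exists (E dE : R -> R) (C : R),
  [/\ elementary E, elementary dE, forall x : R, is_derive x 1 E (dE x) &
  [/\ forall x, x <= 0 -> E x = 0, forall x, 1 <= x -> E x = x,
      forall x, `|E x - Num.max x 0| <= 1 &
  [/\ forall x, `|dE x| <= C, forall x, x < 0 -> dE x = 0 &
      forall x, 1 < x -> dE x = 1]]].
Proof.
(* The two terms never vanish together, since x and 1 - x cannot both be nonpositive. *)
pose den x := expinv 0 x + expinv 0 (-1 * x + 1).
have den_gt0 x : 0 < den x.
  rewrite /den; have [x0|x0] := leP x 0.
    by rewrite ltr_wpDl ?expinv_ge0// expinv_gt0//; lra.
  by rewrite ltr_wpDr ?expinv_ge0// expinv_gt0.
pose E x := x * (expinv 0 x * (den x)^-1).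
have eE : elementary E.
  apply: elementary_mul; first exact: elementary_id.
  apply: elementary_mul; first exact: elementary_expinv.
  apply: elementary_inv; last by move=> x; rewrite gt_eqF.
  apply: elementary_add; first exact: elementary_expinv.
  by apply: elementary_affine; exact: elementary_expinv.
have [dE edE dEE] := elementary_derive eE.
have E0 x : x <= 0 -> E x = 0 by move=> x0; rewrite /E expinv_le0// mul0r mulr0.
have E1 x : 1 <= x -> E x = x.
  move=> x1; rewrite /E /den [X in _ + X]expinv_le0 ?addr0; last by lra.
  by rewrite divff ?mulr1// gt_eqF// expinv_gt0//; lra.
have dE0 x : x < 0 -> dE x = 0.
  move=> x0; have [_ <-] := dEE x.
  suff : is_derive x 1 E 0 by case.
  apply: (@near_eq_is_derive _ _ _ (cst 0)).
  near=> y; rewrite E0//; apply/ltW; near: y; exact: lt_nbhsl.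
have dE1 x : 1 < x -> dE x = 1.
  move=> x0; have [_ <-] := dEE x.
  suff : is_derive x 1 E 1 by case.
  apply: (@near_eq_is_derive _ _ _ id).
  near=> y; rewrite E1//; apply/ltW; near: y; exact: lt_nbhsr.
have cdE := elementary_continuous edE.
have [c _ maxc] := @EVT_max R (fun x => `|dE x|) 0 1 ler01
  (continuous_subspaceT (fun x => continuous_comp (cdE x) (@norm_continuous _ R
    _))).
exists E, dE, (Num.max 1 `|dE c|); split => //; split => //.
  move=> x; have [x0|x0] := leP x 0; first by rewrite E0// subrr normr0.
  have [x1|x1] := leP 1 x; first by rewrite E1// subrr normr0.
  have t1 : expinv 0 x / den x <= 1.
    by rewrite ler_pdivrMr// mul1r /den lerDl expinv_ge0.
  have t0 : 0 <= expinv 0 x / den x by rewrite divr_ge0 ?expinv_ge0// ltW.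
  by rewrite ler_norml /E; apply/andP; split; nra.
split => // x; rewrite le_max.
have [x0|x0] := ltP x 0; first by rewrite dE0// normr0 ler01.
have [x1|x1] := ltP 1 x; first by rewrite dE1// normr1 lexx.
by rewrite maxc ?orbT// in_itv/= x0 x1.
Unshelve. all: by end_near. Qed.

End SmoothRamp.

(** * Sparse representations in finite dimension *)

Section ConicCaratheodory.
Context {K : realFieldType} {V : vectType K} (W : {vspace V}) {I : finType}.
Implicit Types (v : I -> V) (l c : I -> K).

(* Linear independence modulo W of the subfamily of v on the support of l. *)
Definition free_mod v l := forall c, (forall i, l i = 0 -> c i = 0) ->
  \sum_i c i *: v i \in W -> forall i, c i = 0.

Lemma exists_pos_coord c : 0 <= \sum_i c i -> (exists i, c i != 0) ->
  exists i, 0 < c i.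
Proof.
move=> c0 [i ci0]; apply: contrapT => /forallNP npos.
have cle j : 0 <= - c j by rewrite oppr_ge0 leNgt; exact/negP/npos.
have : \sum_j - c j == 0.
  by rewrite eq_le sumr_ge0 ?andbT// sumrN oppr_le0.
rewrite psumr_eq0 // => /allP/(_ i); rewrite mem_index_enum oppr_eq0.
by move=> /(_ isT)/implyP/(_ isT); apply/negP.
Qed.

(** Induction on the size of the support. A relation [c] modulo W on the support is oriented so that
    its coefficients have nonnegative sum; subtracting [t * c] then cannot increase the total mass.
    The largest [t] keeping all weights nonnegative, a minimum of ratios, removes an index from the
    support. *)
Lemma caratheodory_mod v l : (forall i, 0 <= l i) ->
  exists l', [/\ forall i, 0 <= l' i, \sum_i l' i <= \sum_i l i,
    \sum_i l' i *: v i - \sum_i l i *: v i \in W & free_mod v l'].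
Proof.
have [n] := ubnP #|[set i | (l i != 0)%R]%SET|; elim: n l => // n IHn l ltn l0.
have [fl|] := pselect (free_mod v l); first by exists l; rewrite subrr mem0v.
move=> /existsNP[c0 /not_implyP[supp0 /not_implyP[c0W /existsNP[i0 /eqP ci0]]]].
have [c [supp cW [i ci]]] : exists c, [/\ forall i, l i = 0 -> c i = 0,
    \sum_i c i *: v i \in W & 0 <= \sum_i c i /\ exists i, 0 < c i].
  have [s0|s0] := leP 0 (\sum_i c0 i).
    by exists c0; split => //; split => //; apply: exists_pos_coord => //;
      exists i0.
  exists (fun i => - c0 i); split => [i /supp0 ->||]; first by rewrite oppr0.
    by under eq_bigr do rewrite scaleNr; rewrite sumrN memvN.
  have s0' : 0 <= \sum_i - c0 i by rewrite sumrN oppr_ge0 ltW.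
  by split => //; apply: exists_pos_coord => //; exists i0; rewrite oppr_eq0.
case: ci => i1 ci1.
case: (@arg_minP _ _ _ i1 (fun i => 0 < c i) (fun i => l i / c i) ci1) =>
  j cj minj.
set t := l j / c j in minj.
have t0 : 0 <= t by rewrite divr_ge0// ltW.
pose l1 i := l i - t * c i.
have l10 k : 0 <= l1 k.
  rewrite /l1 subr_ge0; have [ck|ck] := ltP 0 (c k).
    by rewrite -ler_pdivlMr// minj.
  by rewrite (le_trans _ (l0 k))// mulr_ge0_le0.
have l1s : \sum_i l1 i <= \sum_i l i.
  by rewrite sumrB lerBlDr lerDl -mulr_sumr mulr_ge0.
have sub1 : [set i | l1 i != 0]%SET \proper [set i | (l i != 0)%R]%SET.
  apply/properP; split.
    apply/fintype.subsetP => k; rewrite !inE; apply: contraNneq => lk.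
    by rewrite /l1 lk supp// mulr0 subr0.
  exists j; rewrite !inE.
    by apply: contraTneq cj => /supp ->; rewrite ltxx.
  by rewrite negbK subr_eq0 /t divfK ?eqxx// gt_eqF.
have [|l2 [l20 l2s l2W fl2]] := IHn l1 _ l10.
  by rewrite -ltnS (leq_trans _ ltn)// ltnS proper_card.
exists l2; split => //; first exact: le_trans l1s.
rewrite (_ : _ - _ = (\sum_i l2 i *: v i - \sum_i l1 i *: v i)
   - t *: \sum_i c i *: v i); first by rewrite memvB// memvZ.
rewrite /l1.
rewrite -addrA; congr (_ + _); rewrite -opprD; congr (- _).
rewrite scaler_sumr -big_split/=; apply: eq_bigr => k _.
by rewrite scalerA -scalerDl subrK.
Qed.

(** The vectors on the support are free and their span meets W only in 0, so the two dimensions add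
    up inside the whole space. *)
Lemma free_mod_card v l : free_mod v l ->
  (#|[set i | (l i != 0)%R]%SET| <= \dim {:V} - \dim W)%N.
Proof.
move=> fl; set A := [set i | (l i != 0)%R]%SET.
pose X := [tuple v (enum_val j) | j < #|A|].
have key (k : 'I_#|A| -> K) : \sum_j k j *: v (enum_val j) \in W ->
    forall j, k j = 0.
  move=> kW j.
  (* Extension of [k] by zero outside the support; each fibre of [enum_val] has at most one
     element. *)
  pose c i := \sum_(j | enum_val j == i) k j.
  have cE j' : c (enum_val j') = k j'.
    rewrite /c (big_pred1 j')// => j2 /=.
    by apply/eqP/eqP => [/enum_val_inj|->].
  rewrite -cE; apply: fl.
    move=> i li; rewrite /c big1// => j2 /eqP ej.
    by have := enum_valP j2; rewrite ej inE li eqxx.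
  suff -> : \sum_i c i *: v i = \sum_j k j *: v (enum_val j) by [].
  rewrite [RHS](partition_big (fun j => enum_val j) xpredT)//=.
  apply: eq_bigr => i _; rewrite /c scaler_suml.
  by apply: eq_bigr => j2 /eqP ->.
have XE (j : 'I_#|A|) : X`_j = v (enum_val j) by rewrite -tnth_nth tnth_mktuple.
have fX : free X.
  apply/freeP => k k0; apply: key.
  by under eq_bigr do rewrite -XE; rewrite k0 mem0v.
have cap0 : (<<X>> :&: W = 0)%VS.
  apply/eqP; rewrite -subv0; apply/subvP => u; rewrite memv_cap => /andP[uX uW].
  rewrite (coord_span uX) in uW *.
  have c0 : forall j, coord X j u = 0.
    apply: key; rewrite (eq_bigr (fun j => coord X j u *: X`_j))// => j _.
    by rewrite XE.
  by rewrite big1 ?mem0v// => j _; rewrite c0 scale0r.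
rewrite leq_subRL ?dimvS ?subvf//.
have <- : \dim <<X>>%VS = #|A| by move/eqP: fX; rewrite size_tuple.
by rewrite addnC -dimv_disjoint_sum// dimvS// subvf.
Qed.

End ConicCaratheodory.

Lemma continuous_sum {R : numFieldType} {T : topologicalType}
    {V : normedModType R} {I : finType} (f : I -> T -> V) :
  (forall i, continuous (f i)) -> continuous (fun x => \sum_i f i x).
Proof.
move=> cf x; rewrite /continuous_at.
elim: (index_enum I) => [|i s IHs].
  by rewrite big_nil; under eq_fun do rewrite big_nil; exact: cvg_cst.
rewrite big_cons; under eq_fun do rewrite big_cons.
by apply: cvgD => //; exact: cf.
Qed.

Lemma continuous_coord {R : realType} (K : eqType) (k : K) :
  continuous (fun p : {ptws K -> R} => p k).
Proof. exact: (@proj_continuous _ (fun=> R^o)). Qed.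

(** Parameters are kept as functions with the product topology, so that boxes are compact by
    Tychonoff's theorem and the parameter space needs no norm. *)
Lemma box_EVT_min {R : realType} (K : eqType) (lo hi : K -> R)
    (f : {ptws K -> R} -> R) :
  (forall k, lo k <= hi k) -> continuous f ->
  exists2 p : K -> R, (forall k, lo k <= p k <= hi k) &
    forall p' : K -> R, (forall k, lo k <= p' k <= hi k) -> f p <= f p'.
Proof.
move=> lohi cf.
have cB := @tychonoff K (fun=> R) (fun k => [set` `[lo k, hi k]])
  (fun k => @segment_compact R _ _).
have [||p pB pmin] := @compact_EVT_min {ptws K -> R} R f _ _ cB.
- by exists lo => k /=; rewrite in_itv/= lexx lohi.
- exact: continuous_subspaceT.
exists p => [k|p' p'B]; first by have := set_mem pB k; rewrite /= in_itv.
by apply: pmin; apply/mem_set => k /=; rewrite in_itv/= p'B.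
Qed.

(** * Differential inequalities from comparisons along a ray *)

Section DirectionalBounds.
Context {R : realType} {V : normedModType R}.
Implicit Types (F : V -> R) (y v : V) (c : R).

(** Only steps [t] in (0, 1] are compared: the mass term of the penalized functional is not
    differentiable, and its variation is controlled on one side only. *)
Lemma diff_ge F y v c : differentiable F y ->
  (forall t : R, 0 < t <= 1 -> F y + t * c <= F (y + t *: v)) -> c <= 'd F y v.
Proof.
move=> dF Fc; rewrite -deriveE//.
have dv : derivable F y v := diff_derivable dF.
rewrite /derive normed_module.cvg_at_rightE//; apply: limr_ge.
  by apply: cvgP; apply: cvg_dnbhs_at_right; exact: dv.
near=> t.
have t0 : 0 < t by [].
have t1 : t <= 1 by near: t; exact: nbhs_right_le.
rewrite -[leRHS]/(t^-1 * (F (t *: v + y) - F y)) ler_pdivlMl// lerBrDl.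
by rewrite [t *: v + y]addrC Fc ?t0.
Unshelve. all: by end_near. Qed.

Lemma diff_le F y v c : differentiable F y ->
  (forall t : R, 0 < t <= 1 -> F (y + t *: v) <= F y + t * c) -> 'd F y v <= c.
Proof.
move=> dF Fc; rewrite -deriveE//.
have dv : derivable F y v := diff_derivable dF.
rewrite /derive normed_module.cvg_at_rightE//; apply: limr_le.
  by apply: cvgP; apply: cvg_dnbhs_at_right; exact: dv.
near=> t.
have t0 : 0 < t by [].
have t1 : t <= 1 by near: t; exact: nbhs_right_le.
rewrite -[leLHS]/(t^-1 * (F (t *: v + y) - F y)) ler_pdivrMl// lerBlDl.
by rewrite [t *: v + y]addrC Fc ?t0.
Unshelve. all: by end_near. Qed.

Lemma convex_diff_le F y z : convex_function setT F -> differentiable F y ->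
  F y + 'd F y (z - y) <= F z.
Proof.
move=> cF dF; rewrite -lerBrDl; apply: diff_le => // t /andP[t0 t1].
have cFt : F (t *: z + (1 - t) *: y) <= t * F z + (1 - t) * F y.
  exact: (cF (Itv01 (ltW t0) t1) z y (in_setT _) (in_setT _)).
have <- : t *: z + (1 - t) *: y = y + t *: (z - y).
  by rewrite scalerBr scalerBl scale1r addrCA.
by apply: (le_trans cFt); lra.
Qed.

End DirectionalBounds.

(** Division by the entry of largest modulus puts [h] on a face of the unit cube, where the norm of
    the combination has a positive minimum. The constant is the least of these minima, capped at 1
    so that it makes sense for an empty family. *)
Lemma free_coord_bound {R : realType} {Y : normedVectType R} d (e :
  d.-tuple Y) :
  free e -> exists2 m : R, 0 < m &
    forall (h : 'I_d -> R) i, m * `|h i| <= `|\sum_(k < d) h k *: e`_k|.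
Proof.
move=> /freeP fe.
pose N (h : {ptws 'I_d -> R}) : R := `|\sum_(k < d) h k *: e`_k|.
have cN : continuous N.
  move=> h; apply: (@cvg_norm _ Y _ (nbhs h)).
  apply: (@continuous_sum R {ptws 'I_d -> R} Y 'I_d (fun k h => h k *: e`_k)).
  move=> k p; apply: (@cvgZr_tmp R Y _ (nbhs p) _ (fun h : {ptws _ -> R} =>
    h k)); exact: continuous_coord.
(* Compactness of the faces of the unit cube replaces equivalence of norms. *)
have face i : exists2 m : R, 0 < m & forall h : 'I_d -> R,
    (forall k, `|h k| <= 1) -> h i = 1 -> m <= N h.
  pose lo k : R := if k == i then 1 else -1.
  have [//|p pB pmin] := @box_EVT_min R 'I_d lo (fun=> 1) N _ cN.
    by move=> k; rewrite /lo; case: ifP => // _; lra.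
  have pi1 : p i = 1.
    by have := pB i; rewrite /lo eqxx => /andP[? ?]; apply/le_anti/andP.
  exists (N p).
    rewrite normr_gt0; apply/eqP => /fe/(_ i)/eqP.
    by rewrite pi1 oner_eq0.
  move=> h h1 hi; apply: pmin => k.
  have := h1 k; rewrite ler_norml /lo => /andP[? ->]; rewrite andbT.
  by case: eqP => [->|//]; rewrite hi.
pose m i := sval (cid2 (face i)).
have m0 i : 0 < m i by rewrite /m; case: cid2.
have mN i h : (forall k, `|h k| <= 1) -> h i = 1 -> m i <= N h.
  by rewrite /m; case: cid2 => /= ? _; apply.
exists (\big[Num.min/1]_i m i).
  by elim/big_ind: _ => // x y x0 y0; rewrite lt_min x0 y0.
move=> h i.
case: (@arg_maxP _ _ _ i xpredT (fun k => `|h k|) isT) => j _ maxj.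
have [hj0|hj0] := eqVneq (h j) 0.
  have := maxj i isT; rewrite /= hj0 normr0 normr_le0 => /eqP ->.
  by rewrite normr0 mulr0.
apply: (@le_trans _ _ (m j * `|h j|)).
  apply: ler_pM => //; last exact: maxj.
    by elim/big_ind: _ => // [x y x0 y0|k _]; rewrite ?le_min ?x0 ?y0// ltW.
  exact: (@bigmin_le_cond _ R _ 1 j xpredT m).
have hk1 k : `|h k / h j| <= 1.
  by rewrite normrM normfV ler_pdivrMr ?normr_gt0// mul1r; exact: maxj.
have := mN j (fun k => h k / h j) hk1 (divff hj0).
rewrite /N; under eq_bigr do rewrite mulrC -scalerA.
by rewrite -scaler_sumr normrZ normfV ler_pdivlMl ?normr_gt0// mulrC.
Qed.

(** * The penalized problem over finitely many atoms *)

Section SparseMinimizer.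
Context {R : realType} {Y : normedVectType R} (F : Y -> R) (HL : {vspace Y}).
Context (T : R) (a : bool -> R -> Y).
Hypothesis T_gt0 : 0 < T.
Hypothesis F_convex : convex_function setT F.
Hypothesis F_diff : forall y, differentiable F y.
Hypothesis F_coercive : norm_coercive F.
Hypothesis a_cont : forall b, continuous (a b).
(** Atoms at the end points are absorbed by HL; positions may thus range over the compact interval
    [0, T]. *)
Hypothesis a_out : forall b (x : R), x \notin `]0, T[ -> a b x \in HL.

(** The boolean is the kind of the atom, step or ramp; the ordinal is one of the [m] slots offered
    to each kind. *)
Local Notation J m := (bool * 'I_m)%type.

Definition penalized m (l x : J m -> R) (h : Y) : R :=
  F (\sum_j l j *: a j.1 (x j) + h) + \sum_j `|l j|.

(** Coercivity bounds the sublevel set, and the tangent of F at 0 then bounds F from below on it.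
    The bound on [F 0 - F y] is what limits the total mass of a competitor whose penalized value is
    below [F 0]. *)
Lemma coercive_sublevel : exists2 C : R, 0 <= C & exists2 r : R, 0 <= r &
  forall y, F y <= F 0 -> `|y| <= r /\ F 0 - F y <= C.
Proof.
have [r0 hr0] := F_coercive (F 0 + 1).
have cd : bounded_near ('d F 0 : Y -> R) (nbhs (0 : Y)).
  by apply/linear_bounded_continuous; exact: diff_continuous.
have /linear_boundedP [M [_ hM]] := cd.
pose C := Num.max M 0 + 1.
have C0 : 0 <= C by rewrite addr_ge0// le_max lexx orbT.
have MC : M < C by rewrite ltr_pwDr// le_max lexx.
pose r := Num.max r0 0.
have r_ge0 : 0 <= r by rewrite le_max lexx orbT.
exists (C * r); first by rewrite mulr_ge0.
exists r => // y Fy.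
have yr : `|y| <= r.
  rewrite leNgt; apply/negP => ry.
  have : F 0 + 1 <= F y by apply: hr0; rewrite (le_trans _ (ltW ry))// le_max
    lexx.
  by rewrite leNgt => /negP; apply; rewrite (le_lt_trans Fy)// ltrDl.
split => //.
have := convex_diff_le y F_convex (F_diff 0); rewrite subr0 => h1.
have := hM C MC y; rewrite ler_norml => /andP[h2 _].
have h3 : C * `|y| <= C * r by rewrite ler_wpM2l.
by lra.
Qed.

Lemma atom_bound : exists2 A : R, 0 <= A &
  forall b (x : R), 0 <= x <= T -> `|a b x| <= A.
Proof.
have cn b : {within `[0, T], continuous (fun x => `|a b x|)}.
  apply: continuous_subspaceT => x; apply: (@cvg_norm _ Y _ (nbhs x)).
  exact: a_cont.
have [c0 _ m0] := EVT_max (ltW T_gt0) (cn false).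
have [c1 _ m1] := EVT_max (ltW T_gt0) (cn true).
exists (Num.max `|a false c0| `|a true c1|); first by rewrite le_max normr_ge0.
by case=> x xT; rewrite le_max ?m0 ?m1 ?orbT//.
Qed.

Lemma penalized_minimizer m : exists (l x : J m -> R) (h : Y),
  [/\ forall j, 0 <= x j <= T, h \in HL &
      forall (l' x' : J m -> R) h', (forall j, 0 <= x' j <= T) -> h' \in HL ->
        penalized l x h <= penalized l' x' h'].
Proof.
have [C C0 [r r0 hr]] := coercive_sublevel.
have [A A0 hA] := atom_bound.
pose e := vbasis HL.
have fe : free e by exact: basis_free (vbasisP HL).
have [mu mu0 hmu] := free_coord_bound fe.
pose d := \dim HL.
(* All parameters in one finite family: masses, positions, and coordinates of [h] in a basis of
   HL. *)
pose K := (J m + J m + 'I_d)%type.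
pose L (p : K -> R) j := p (inl (inl j)).
pose X (p : K -> R) j := p (inl (inr j)).
pose Hp (p : K -> R) := \sum_(i < d) p (inr i) *: e`_i.
pose G (p : {ptws K -> R}) : R := penalized (L p) (X p) (Hp p).
(* Below the level [F 0], [h] is a point of norm at most [r] minus a combination of atoms of total
   mass at most [C]; [mu] converts this into a bound on coordinates. *)
pose B := (r + C * A) / mu.
have B0 : 0 <= B by rewrite divr_ge0 ?addr_ge0 ?mulr_ge0// ltW.
pose lo (k : K) : R := match k with inl (inl _) => - C | inl (inr _) =>
  0 | inr _ => - B end.
pose hi (k : K) : R := match k with inl (inl _) => C | inl (inr _) =>
  T | inr _ => B end.
have cG : continuous G.
  move=> p.
  have cin : {for p, continuous (fun p : {ptws K -> R} =>
      \sum_j L p j *: a j.1 (X p j) + Hp p)}.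
    apply: (@cvgD _ Y _ (nbhs p)).
      apply: (@continuous_sum R {ptws K -> R} Y (J m)
        (fun j p => L p j *: a j.1 (X p j))) => j q.
      apply: (@cvgZ _ Y _ (nbhs q) _ (fun p : {ptws K -> R} => L p j)).
        exact: (@continuous_coord R K (inl (inl j)) q).
      apply: (@continuous_comp {ptws K -> R} R Y (fun p => X p j) (a j.1)).
        exact: (@continuous_coord R K (inl (inr j)) q).
      exact: a_cont.
    apply: (@continuous_sum R {ptws K -> R} Y 'I_d
      (fun i p => p (inr i) *: e`_i)) => i q.
    apply: (@cvgZr_tmp R Y _ (nbhs q) _ (fun p : {ptws K -> R} => p (inr i))).
    exact: (@continuous_coord R K (inr i) q).
  apply: (@cvgD _ R _ (nbhs p)).
    apply: (continuous_comp cin).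
    exact: differentiable_continuous.
  apply: (@continuous_sum R {ptws K -> R} R (J m) (fun j p => `|L p j|)) => j q.
  apply: (@cvg_norm _ R _ (nbhs q)).
  exact: (@continuous_coord R K (inl (inl j)) q).
have [|p pB pmin] := @box_EVT_min R K lo hi G _ cG.
  by case=> [[|]|] /=; rewrite ?(ltW T_gt0)// => _; lra.
have HpHL q : Hp q \in HL.
  by apply: memv_suml => i _; rewrite memvZ// vbasis_mem// mem_nth// size_tuple.
exists (L p), (X p), (Hp p); split => // [j|l x h xT hHL].
  exact: (pB (inl (inr j))).
have G0 : G p <= F 0.
  have -> : F 0 = G (fun=> 0).
    rewrite /G /penalized /Hp /L big1 ?add0r => [|j _]; last by rewrite scale0r.
    rewrite big1 => [|j _]; last by rewrite scale0r.
    by rewrite big1 ?addr0// => j _; rewrite normr0.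
  by apply: pmin => -[[|]|] /= _; rewrite ?lexx ?(ltW T_gt0)//; lra.
(* Competitors at or above the level [F 0] lose against the zero parameter; only the others must be
   shown to lie in the box. *)
have [/(le_trans G0)//|big] := leP (F 0) (penalized l x h).
pose q (k : K) : R := match k with inl (inl j) => l j | inl (inr j) => x j
  | inr i => coord e i h end.
have Hq : Hp q = h by rewrite /Hp /q [RHS](coord_vbasis hHL).
have -> : penalized l x h = G q by rewrite /G Hq.
have S0 : 0 <= \sum_j `|l j| by exact: sumr_ge0.
set y := \sum_j l j *: a j.1 (x j) + h.
have Fy : F y <= F 0.
  by apply: ltW; apply: le_lt_trans big; rewrite /penalized lerDl.
have [yr Fc] := hr y Fy.
have SC : \sum_j `|l j| <= C.
  by move: big; rewrite /penalized -/y; lra.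
have lC j : `|l j| <= C.
  apply: le_trans SC; rewrite (bigD1 j)//= lerDl; exact: sumr_ge0.
apply: pmin => -[[j|j]|i] /=; rewrite -?ler_norml//.
rewrite /B ler_pdivlMr// mulrC.
apply: (le_trans (hmu (fun i => coord e i h) i)).
rewrite -(coord_vbasis hHL).
have -> : h = y - \sum_j l j *: a j.1 (x j) by rewrite /y addrC addKr.
apply: (le_trans (ler_normB _ _)); apply: lerD => //.
apply: (le_trans (ler_norm_sum _ _ _)).
apply: (@le_trans _ _ (\sum_j `|l j| * A)).
  by apply: ler_sum => j _; rewrite normrZ ler_wpM2l// hA.
by rewrite -mulr_suml ler_wpM2r.
Qed.

(** Independence modulo HL does more than count atoms: no surviving atom lies in HL, which places it
    inside (0, T), and no two atoms of the same kind share a position. *)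
Lemma sparse_minimizer : exists m (l x : J m -> R) (h y : Y),
  [/\ h \in HL, y = \sum_j l j *: a j.1 (x j) + h,
      [/\ (#|[set j | (l j != 0)%R]%SET| <= \dim {:Y} - \dim HL)%N,
          forall j, l j != 0 -> x j \in `]0, T[ &
          forall j k, l j != 0 -> l k != 0 -> j.1 = k.1 -> x j = x k -> j = k] &
   [/\ forall z, F y + 'd F y (z - y) <= F z,
       forall h0, h0 \in HL -> 'd F y h0 = 0,
       forall b t, `|'d F y (a b t)| <= 1 &
       \sum_j `|l j| <= - 'd F y y]].
Proof.
set n := (\dim {:Y} - \dim HL)%N.
have [l0 [x [h0 [xT h0HL min0]]]] := penalized_minimizer n.+1.
(* Signs go into the vectors, so that the conic reduction applies to the weights [|l0 j|]. *)
pose v j := Num.sg (l0 j) *: a j.1 (x j).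
have [l' [l'0 l's l'W fl]] := @caratheodory_mod _ _ HL _ v (fun j => `|l0 j|)
  (fun j => normr_ge0 _).
pose l (j : J n.+1) := l' j * Num.sg (l0 j).
(* The reduction preserves the sum only modulo HL; the discrepancy is moved into [h], which leaves
   the point [y] unchanged. *)
pose h := h0 - (\sum_j l' j *: v j - \sum_j `|l0 j| *: v j).
have hHL : h \in HL by rewrite memvB.
have yE : \sum_j l j *: a j.1 (x j) + h = \sum_j l0 j *: a j.1 (x j) + h0.
  have -> : \sum_j l j *: a j.1 (x j) = \sum_j l' j *: v j.
    by apply: eq_bigr => j _; rewrite /l -scalerA.
  have -> : \sum_j l0 j *: a j.1 (x j) = \sum_j `|l0 j| *: v j.
    by apply: eq_bigr => j _; rewrite /v scalerA mulrC -numEsg.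
  by rewrite /h opprB [h0 + _]addrC addrA; congr (_ + _); rewrite addrC subrK.
have ls : \sum_j `|l j| <= \sum_j `|l0 j|.
  apply: le_trans l's; apply: ler_sum => j _.
  rewrite normrM (ger0_norm (l'0 j)) ler_piMr// normr_sg.
  by case: (l0 j != 0).
have min (l1 x1 : J n.+1 -> R) h1 : (forall j, 0 <= x1 j <= T) -> h1 \in HL ->
    penalized l x h <= penalized l1 x1 h1.
  move=> x1T h1HL; apply: (le_trans _ (min0 _ _ _ x1T h1HL)).
  by rewrite /penalized yE lerD2l.
have l_l' j : l j != 0 -> l' j != 0 /\ l0 j != 0.
  by rewrite mulf_eq0 negb_or sgr_eq0 => /andP.
have card : (#|[set j | (l j != 0)%R]%SET| <= n)%N.
  apply: leq_trans (free_mod_card fl); apply: subset_leq_card.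
  by apply/fintype.subsetP => j; rewrite !inE => /l_l'[].
set y := \sum_j l j *: a j.1 (x j) + h.
have x_in j : l j != 0 -> x j \in `]0, T[.
  move=> /l_l'[l'j _]; apply: contraT => /(a_out j.1) aj.
  have c0 i : l' i = 0 -> (i == j)%:R = 0 :> R.
    by move=> l'i; case: eqP => // ij; rewrite -ij l'i eqxx in l'j.
  have cW : \sum_i (i == j)%:R *: v i \in HL.
    rewrite (bigD1 j)//= big1 => [|i /negbTE ->]; last by rewrite scale0r.
    by rewrite eqxx scale1r addr0 memvZ.
  by have /eqP := fl _ c0 cW j; rewrite eqxx oner_eq0.
have inj j k : l j != 0 -> l k != 0 -> j.1 = k.1 -> x j = x k -> j = k.
  move=> /l_l'[l'j l0j] /l_l'[l'k l0k] jk xjk; apply: contrapT => /eqP njk.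
  pose c i := (i == j)%:R * Num.sg (l0 j) - (i == k)%:R * Num.sg (l0 k).
  have c0 i : l' i = 0 -> c i = 0.
    move=> l'i; rewrite /c; case: eqP => [ij|_].
      by rewrite -ij l'i eqxx in l'j.
    case: eqP => [ij|_]; first by rewrite -ij l'i eqxx in l'k.
    by rewrite !mul0r subrr.
  have cW : \sum_i c i *: v i \in HL.
    rewrite (bigD1 j)//= (bigD1 k)/=; last by rewrite eq_sym.
    rewrite big1 => [|i /andP[/negbTE ij /negbTE ik]]; last first.
      by rewrite /c ij ik !mul0r subrr scale0r.
    rewrite /c !eqxx (negbTE njk) eq_sym (negbTE njk).
    rewrite !mul0r !mul1r subr0 sub0r addr0 /v !scalerA mulNr -!expr2 !sqr_sg.
    by rewrite l0j l0k jk xjk scaleN1r scale1r subrr mem0v.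
  have /eqP := fl _ c0 cW j.
  by rewrite /c eqxx (negbTE njk) mul1r mul0r subr0 sgr_eq0 (negbTE l0j).
exists n.+1, l, x, h, y; split => //.
have dh0 h1 : h1 \in HL -> 0 <= 'd F y h1.
  move=> h1HL; apply: diff_ge => // t _; rewrite mulr0 addr0.
  have := min l x (h + t *: h1) xT; rewrite memvD ?memvZ// => /(_ isT).
  by rewrite /penalized lerD2r [_ + (h + _)]addrA.
have dh h1 : h1 \in HL -> 'd F y h1 = 0.
  move=> h1HL; apply/le_anti; rewrite dh0// andbT.
  have := dh0 (- h1); rewrite memvN => /(_ h1HL).
  by rewrite linearN oppr_ge0.
split => //.
- by move=> z; exact: convex_diff_le.
- move=> b t; have [tT|tT] := boolP (t \in `]0, T[); last first.
    by rewrite dh ?normr0// a_out.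
  (* There are n.+1 slots of each kind, of which at most n are occupied. *)
  have [i lbi] : exists i, l (b, i) = 0.
    apply: contrapT => /forallNP nz.
    suff : (n.+1 <= n)%N by rewrite ltnn.
    apply: leq_trans card.
    have injb : injective (fun i : 'I_n.+1 => (b, i)) by move=> ? ? [].
    rewrite -[X in (X <= _)%N](card_ord n.+1) -(card_imset _ injb).
    apply: subset_leq_card; apply/fintype.subsetP => _ /imsetP[i _ ->].
    by rewrite inE; exact/eqP/nz.
  (* Filling the empty slot with mass [u * s] moves [y] along the atom and raises the penalty by
     exactly [u]. *)
  have pert s : `|s| = 1 -> -1 <= 'd F y (s *: a b t).
    move=> s1; apply: diff_ge => // u /andP[u0 _].
    pose l1 j := if j == (b, i) then u * s else l j.
    pose x1 j := if j == (b, i) then t else x j.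
    have x1T j : 0 <= x1 j <= T.
      rewrite /x1; case: ifP => // _; move: tT; rewrite in_itv/=.
      by move=> /andP[? ?]; apply/andP; split; exact: ltW.
    have E1 : \sum_j l1 j *: a j.1 (x1 j) + h = y + u *: (s *: a b t).
      have l1bi : l1 (b, i) = u * s by rewrite /l1 eqxx.
      have x1bi : x1 (b, i) = t by rewrite /x1 eqxx.
      rewrite (bigD1 (b, i))//= l1bi x1bi -scalerA /y.
      rewrite [X in _ = X + _ + _](bigD1 (b, i))//= lbi scale0r add0r.
      rewrite -addrA addrC; congr (_ + _ + _); apply: eq_bigr => j /negbTE jbi.
      by rewrite /l1 /x1 jbi.
    have E2 : \sum_j `|l1 j| = \sum_j `|l j| + u.
      rewrite (bigD1 (b, i))//= [in RHS](bigD1 (b, i))//= lbi normr0 add0r.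
      rewrite {1}/l1 eqxx normrM s1 mulr1 gtr0_norm// addrC; congr (_ + _).
      by apply: eq_bigr => j /negbTE jbi; rewrite /l1 jbi.
    have := min l1 x1 h x1T hHL; rewrite /penalized E1 E2 -/y; lra.
  have := pert 1 (normr1 _); rewrite scale1r.
  have := pert (-1); rewrite normrN1 => /(_ erefl); rewrite scaleN1r linearN.
  by rewrite ler_norml => ? ?; apply/andP; split; lra.
(* Scaling all masses by 1 - t saves [t] times the total mass and moves [y] by - t (y - h). *)
- have sc : \sum_j `|l j| <= 'd F y (- (y - h)).
    apply: diff_ge => // t /andP[t0 t1].
    have := min (fun j => (1 - t) * l j) x h xT hHL; rewrite /penalized -/y.
    have -> : \sum_j ((1 - t) * l j) *: a j.1 (x j) + h = y + t *: - (y - h).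
      under eq_bigr do rewrite -scalerA.
      rewrite -scaler_sumr.
      rewrite (_ : \sum_j l j *: a j.1 (x j) = y - h); last by rewrite addrK.
      by rewrite scalerBl scale1r scalerN addrAC subrK.
    rewrite [X in _ <= _ + X](eq_bigr (fun j => (1 - t) * `|l j|)) => [|j _].
      by rewrite -mulr_sumr; lra.
    by rewrite normrM ger0_norm// subr_ge0.
  by move: sc; rewrite linearN linearB/= (dh h hHL) subr0.
Qed.

End SparseMinimizer.

(** * Square-integrable functions on (0, T) *)

Section IntegralRestriction.
Local Open Scope ereal_scope.
Context d (X : measurableType d) (R : realType).
Variables (m : {measure set X -> \bar R}) (D : set X) (mD : measurable D).

Import HBNNSimple.

Let integral_mrestr_indic (E : set X) : measurable E ->
  \int[mrestr m mD]_x (\1_E x)%:E = \int[m]_(x in D) (\1_E x)%:E.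
Proof. by move=> mE; rewrite !integral_indic// setIT. Qed.

Let integral_mrestr_nnsfun (h : {nnsfun X >-> R}) :
  \int[mrestr m mD]_x (h x)%:E = \int[m]_(x in D) (h x)%:E.
Proof.
under [LHS]eq_integral do rewrite fimfunE -fsumEFin//.
rewrite [LHS]ge0_integral_fsum//; last 2 first.
  - by move=> r; exact/measurable_EFinP/measurableT_comp.
  - by move=> n x _; rewrite EFinM nnfun_muleindic_ge0.
under [RHS]eq_integral do rewrite fimfunE -fsumEFin//.
rewrite [RHS]ge0_integral_fsum//; last 2 first.
  - by move=> r; exact/measurable_EFinP/measurableT_comp.
  - by move=> n x _; rewrite EFinM nnfun_muleindic_ge0.
apply: eq_fsbigr => r _.
by rewrite !integralZl_indic_nnsfun//= integral_mrestr_indic.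
Qed.

(** Indicators, simple functions, then monotone convergence. It links the L^2 norm, taken for the
    restricted measure, with integrals over the set (0, T). *)
Lemma ge0_integral_mrestr (f : X -> \bar R) : measurable_fun setT f ->
  (forall x, 0 <= f x) ->
  \int[mrestr m mD]_x f x = \int[m]_(x in D) f x.
Proof.
move=> mf f0; pose f_ := nnsfun_approx measurableT mf.
transitivity (limn (fun n => \int[mrestr m mD]_x (f_ n x)%:E)).
  rewrite -monotone_convergence//=.
  - apply: eq_integral => x _; apply/esym/cvg_lim => //=.
    exact: cvg_nnsfun_approx.
  - by move=> n; apply: measurableT_comp => //; exact: measurable_funTS.
  - by move=> n x _; rewrite lee_fin.
  - by move=> x _ a b ab; rewrite lee_fin//; exact/lefP/nd_nnsfun_approx.
transitivity (limn (fun n => \int[m]_(x in D) (f_ n x)%:E)).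
  by congr (limn _); apply/funext => n /=; rewrite integral_mrestr_nnsfun.
rewrite -monotone_convergence//=.
- apply: eq_integral => x _; apply/cvg_lim => //=.
  exact: cvg_nnsfun_approx.
- by move=> n; exact/measurable_EFinP/measurable_funTS.
- by move=> n x _; rewrite lee_fin.
- by move=> x _ a b ab; rewrite lee_fin//; exact/lefP/nd_nnsfun_approx.
Qed.

End IntegralRestriction.

Section L2Interval.
Context {R : realType} (T : R).
Local Notation mu := (@lebesgue_measure R).
Local Notation D := (`]0, T[%classic : set R).
Implicit Types u v w : R -> R.

Lemma mu0T_fin : (mu D < +oo)%E.
Proof. by rewrite /= lebesgue_measure_itv/=; case: ifPn => // _;
  rewrite ltry. Qed.

Lemma L2norm_sqr u : measurable_fun setT u ->
  ((L2norm T u) `^ 2 = \int[mu]_(x in D) (u x ^+ 2)%:E)%E.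
Proof.
move=> mu_; rewrite /L2norm powR_Lnorm ?pnatr_eq0//.
rewrite (_ : (fun x => _) = fun x => (u x ^+ 2)%:E); last first.
  apply/funext => x /=.
  by rewrite -[2%R]/(2%:R) powR_mulrn ?normr_ge0// real_normK// num_real.
rewrite ge0_integral_mrestr// => [|x]; last by rewrite lee_fin sqr_ge0.
exact/measurable_EFinP/measurable_funX.
Qed.

Lemma L2norm_lt u (e : R) : measurable_fun setT u -> 0 < e ->
  (\int[mu]_(x in D) (u x ^+ 2)%:E < (e ^+ 2)%:E)%E -> (L2norm T u < e%:E)%E.
Proof.
move=> mu_ e0 h; rewrite ltNge; apply/negP => le.
have : (e%:E `^ 2 <= (L2norm T u) `^ 2)%E.
  by apply: gt0_ler_poweR => //; rewrite ?in_itv/= ?leey ?lee_fin ?(ltW e0)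
    ?Lnorm_ge0.
rewrite L2norm_sqr// poweR_EFin -[2%R]/(2%:R) powR_mulrn ?(ltW e0)//.
by move=> h2; have := lt_le_trans h h2; rewrite ltxx.
Qed.

Lemma Lfun_of_bounded (p : R) u (M : R) : 1 <= p -> measurable_fun setT u ->
  (forall x, x \in `]0, T[ -> `|u x| <= M) ->
  u \in Lfun (lebesgue0T T) p%:E.
Proof.
move=> p1 mu_ uM; rewrite inE; apply/andP; split; rewrite inE//=.
rewrite /finite_norm.
have p0 : p != 0 by rewrite gt_eqF// (lt_le_trans ltr01).
rewrite unlock /Lnorm; apply: poweR_lty.
rewrite ge0_integral_mrestr//; last first.
- by move=> x; exact: poweR_ge0.
- under eq_fun do rewrite /= -/(abse _)%E.
  apply/measurable_EFinP. 
  apply: (measurableT_comp (measurable_powR _)); exact: measurableT_comp.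
apply: (@le_lt_trans _ _ (\int[mu]_(x in D) ((Num.max M 0) `^ p)%:E)%E).
  apply: ge0_le_integral => //.
  - by move=> x _; rewrite poweR_ge0.
  - apply/measurable_EFinP/measurable_funTS.
    apply: (measurableT_comp (measurable_powR _)); exact: measurableT_comp.
  - move=> x xD; rewrite lee_fin ge0_ler_powR ?nnegrE//.
    + by rewrite (le_trans _ p1).
    + by rewrite le_max lexx orbT.
    + by rewrite le_max uM.
rewrite integral_cst//= lte_mul_pinfty ?lee_fin ?powR_ge0//.
exact: mu0T_fin.
Qed.

Lemma Lfun1_integrable0T u : u \in Lfun (lebesgue0T T) 1 ->
  mu.-integrable D (EFin \o u).
Proof.
move=> /[dup] uL /Lfun1_integrable /integrableP[mu_ iu].
apply/integrableP; split; first exact: measurable_funTS.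
rewrite -(@ge0_integral_mrestr _ _ _ mu D (measurable_itv `]0, T[)
  (fun x => `|(EFin \o u) x|%E))//.
exact: measurableT_comp.
Qed.

Lemma L2_Lfun1 (u : L2 T) : (u : R -> R) \in Lfun (lebesgue0T T) 1.
Proof.
apply: Lfun_subset12; last exact: LfunP.
rewrite ge0_fin_numE//=; rewrite /lebesgue0T /mrestr setTI; exact: mu0T_fin.
Qed.

Lemma ae_lebesgue0T (P : R -> Prop) : (forall x, x \in `]0, T[ -> P x) ->
  {ae lebesgue0T T, forall x, P x}.
Proof.
move=> hP; exists (~` D); split.
- by apply: measurableC; exact: measurable_itv.
- by rewrite /lebesgue0T /= /mrestr setICl measure0.
- by move=> x /= nP xD; apply: nP; exact: hP.
Qed.

Lemma L2norm_ae0 u : u = cst 0 %[ae lebesgue0T T] -> measurable_fun setT u ->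
  L2norm T u = 0%E.
Proof.
move=> u0 mu_; have -> : 0%E = L2norm T (cst 0).
  rewrite /L2norm (_ : _ \o _ = cst 0%E)// Lnorm0//.
rewrite /L2norm unlock /Lnorm; apply: (congr1 (poweR^~ _)).
have mp (f : R -> R) : measurable_fun setT f ->
    measurable_fun setT (fun x => `|(EFin \o f) x| `^ 2)%E.
  move=> mf; apply/measurable_EFinP.
  apply: (measurableT_comp (measurable_powR _)); exact: measurableT_comp.
apply: ae_eq_integral => //; [exact: mp|exact: mp|].
case: u0 => N [mN N0 sub]; exists N; split => // x h.
by apply: sub => /= h2; apply: h => _ /=; rewrite h2.
Qed.

(** L^2 estimates between steps and ramps all reduce to a uniform bound and the length of an
    interval carrying the difference. *)
Lemma L2norm_lt_support u (M a b e : R) : measurable_fun setT u -> a <= b ->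
  0 < e -> (forall x, x \in `]0, T[ -> `|u x| <= M) ->
  (forall x, x \in `]0, T[ -> x \notin `[a, b] -> u x = 0) ->
  M ^+ 2 * (b - a) < e ^+ 2 -> (L2norm T u < e%:E)%E.
Proof.
move=> mu_ ab e0 uM u0 Me; apply: L2norm_lt => //.
pose I : set R := `[a, b]%classic.
apply: (@le_lt_trans _ _ (\int[mu]_(x in I) (M ^+ 2)%:E)%E); last first.
  have muI : mu `[a, b]%classic = (b - a)%:E.
    rewrite lebesgue_measure_itv/= lte_fin; case: ltP => // ba.
    by rewrite (@le_anti _ _ a b) ?ab// subrr.
  rewrite integral_cst; last exact: measurable_itv.
  rewrite [X in (_ * X)%E](_ : _ = (b - a)%:E).
    by rewrite -EFinM lte_fin.
  exact: muI.
rewrite integral_mkcond [leRHS]integral_mkcond.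
apply: ge0_le_integral => //.
- by move=> x _; rewrite /patch; case: ifP => // _; rewrite lee_fin sqr_ge0.
- apply: (measurable_restrictT _ (measurable_itv _)).1.
  exact/measurable_EFinP/measurable_funX/measurable_funTS.
- by apply: (measurable_restrictT _ (measurable_itv _)).1.
- move=> x _; rewrite /patch; case: ifPn => xD; last first.
    by case: ifP => // _; rewrite lee_fin sqr_ge0.
  move: xD; rewrite inE/= => xD; case: ifPn => xI.
    by rewrite lee_fin -real_normK ?num_real// lerXn2r ?nnegrE// ?uM//
      (le_trans _ (uM x xD)).
  by rewrite u0// ?expr0n//=; move: xI; apply: contra => ?; rewrite inE.
Qed.

End L2Interval.

(** * Continuous functions vanishing at the boundary and measures *)

Section BoundedProducts.
Context {R : realType} (T : R).
Local Notation mu := (@lebesgue_measure R).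
Local Notation D := (`]0, T[%classic : set R).
Implicit Types (u v w phi psi : R -> R) (c M : R).

Lemma integrable_mul_bounded u phi M : mu.-integrable D (EFin \o u) ->
  measurable_fun setT phi -> (forall x, x \in `]0, T[ -> `|phi x| <= M) ->
  mu.-integrable D (EFin \o (fun x => u x * phi x)).
Proof.
move=> iu mphi phiM.
rewrite (_ : _ \o _ = (EFin \o u) \* (EFin \o phi))%E; last first.
  by apply/funext => x /=; rewrite EFinM.
apply: integrableMl => //; first exact: measurable_funTS.
exists M; split; first exact: num_real.
by move=> k Mk x xD; apply: (le_trans (phiM x xD)); exact: ltW.
Qed.

Lemma normr_Rintegral_mul_le u phi M : mu.-integrable D (EFin \o u) ->
  measurable_fun setT phi -> (forall x, x \in `]0, T[ -> `|phi x| <= M) ->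
  `|\int[mu]_(x in D) (u x * phi x)| <= M * \int[mu]_(x in D) `|u x|.
Proof.
move=> iu mphi phiM; have mD : @measurable _ (measurableTypeR R) D by exact:
  measurable_itv.
have iuphi := integrable_mul_bounded iu mphi phiM.
apply: (le_trans (le_normr_Rintegral mD iuphi)).
have iu' : mu.-integrable D (EFin \o (fun x => `|u x|)).
  exact: (integrable_norm iu).
rewrite -RintegralZl//; apply: le_Rintegral => //.
- exact: (integrable_norm iuphi).
- rewrite (_ : _ \o _ = fun x : R => (M%:E * (EFin \o (fun x : R =>
    `|u x|)%R) x)%E).
    exact: integrableZl.
  by apply/funext => x /=; rewrite EFinM.
- by move=> x xD; rewrite normrM mulrC ler_wpM2r// phiM.
Qed.

Lemma C0_bounded phi : C0 T phi -> exists2 M : R, 0 < M & forall x,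
  `|phi x| <= M.
Proof.
move=> [cphi phi0]; have [T0|T0] := leP 0 T.
  have [c _ hc] := @EVT_max R (fun x => `|phi x|) 0 T T0
   (continuous_subspaceT (fun x => continuous_comp (cphi x) (@norm_continuous _
     R _))).
  exists (`|phi c| + 1); first by rewrite ltr_wpDl.
  move=> x; have [xD|xD] := boolP (x \in `]0, T[); last first.
    by rewrite phi0// normr0 addr_ge0.
  by rewrite ler_wpDr// hc//; exact: subset_itv_oo_cc.
exists 1 => // x; rewrite phi0 ?normr0// in_itv/= negb_and -!leNgt.
by have [//|x0] := leP x 0; rewrite (ltW (lt_trans T0 x0)).
Qed.

Lemma C0_measurable phi : C0 T phi -> measurable_fun setT phi.
Proof. by move=> [cphi _]; exact: continuous_measurable_fun. Qed.

Lemma C0_lin c phi psi : C0 T phi -> C0 T psi -> C0 T (c *: phi + psi).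
Proof.
move=> [cphi phi0] [cpsi psi0]; split.
  move=> x; apply: cvgD; last exact: cpsi.
  by apply: cvgZl_tmp; exact: cphi.
by move=> x xD; rewrite -[LHS]/(c * phi x + psi x) phi0// psi0// mulr0 addr0.
Qed.

Lemma C0_cst0 : C0 T (cst 0).
Proof. by split => // x; exact: cvg_cst. Qed.

End BoundedProducts.

Section DualNorm.
Context {R : realType} (T : R).
Implicit Types (m : (R -> R) -> R) (phi : R -> R) (M c : R).

Lemma unorm_le phi M : (unorm T phi <= M%:E)%E <->
  forall x, x \in `]0, T[ -> `|phi x| <= M.
Proof.
split=> [h x xD|h].
  by rewrite -lee_fin; apply: le_trans h; apply: ereal_sup_ubound; exists x.
by apply: ge_ereal_sup => _ [x xD <-]; rewrite lee_fin h.
Qed.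

Lemma mnorm_le m c : (forall phi, C0 T phi -> (forall x, `|phi x| <= 1) ->
  `|m phi| <= c) ->
  (mnorm T m <= c%:E)%E.
Proof.
move=> h; apply: ge_ereal_sup => _ [phi [Cphi phi1] <-].
rewrite lee_fin h// => x; have [xD|xD] := boolP (x \in `]0, T[).
  exact: (unorm_le _ _).1.
by rewrite Cphi.2// normr0.
Qed.

Definition linear_on_C0 m := forall c phi psi, C0 T phi -> C0 T psi ->
  m (c *: phi + psi) = c * m phi + m psi.

Lemma linear_on_C0_0 m : linear_on_C0 m -> m (cst 0) = 0.
Proof.
move=> lm; have := lm (-1) _ _ (C0_cst0 T) (C0_cst0 T).
rewrite (_ : _ *: _ + _ = cst 0); first by rewrite mulN1r addNr.
by apply/funext => x; rewrite -[LHS]/(-1 * 0 + 0) mulr0 addr0.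
Qed.

Lemma linear_on_C0Z m c phi : linear_on_C0 m -> C0 T phi ->
  m (c *: phi) = c * m phi.
Proof.
move=> lm Cphi; have := lm c _ _ Cphi (C0_cst0 T).
by rewrite (linear_on_C0_0 lm) !addr0.
Qed.

Lemma le_mnorm m phi M : linear_on_C0 m -> C0 T phi -> 0 < M ->
  (forall x, `|phi x| <= M) -> (`|m phi|%:E <= M%:E * mnorm T m)%E.
Proof.
move=> lm Cphi M0 phiM.
have M0' : M^-1%:E \is a fin_num by [].
rewrite -lee_pdivrMl// -EFinM; apply: ereal_sup_ubound.
exists (M^-1 *: phi).
  split.
    by rewrite -[X in C0 T X]addr0; exact: (C0_lin _ Cphi (C0_cst0 T)).
  apply/unorm_le => x xD; rewrite -[_ x]/(M^-1 * phi x) normrM.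
  by rewrite gtr0_norm ?invr_gt0// ler_pdivrMl// mulr1.
by rewrite linear_on_C0Z// normrM gtr0_norm ?invr_gt0.
Qed.

Lemma le_mnorm_fin m : linear_on_C0 m -> (mnorm T m < +oo)%E ->
  exists2 K : R, 0 <= K & forall phi M, C0 T phi -> 0 < M ->
    (forall x, `|phi x| <= M) -> `|m phi| <= K * M.
Proof.
move=> lm mfin.
have m0 : (0 <= mnorm T m)%E.
  apply: (@le_trans _ _ (`|m (cst 0)|%:E)); first by rewrite lee_fin.
  apply: ereal_sup_ubound; exists (cst 0) => //; split; first exact: C0_cst0.
  by apply/unorm_le => x _; rewrite normr0.
have mfn : mnorm T m \is a fin_num by rewrite ge0_fin_numE.
exists (fine (mnorm T m)); first exact: fine_ge0.
move=> phi M Cphi M0 phiM; rewrite -lee_fin mulrC EFinM fineK//.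
exact: le_mnorm.
Qed.

End DualNorm.

(** * Distributional derivatives of step and ramp functions *)

Section DistributionalDerivatives.
Context {R : realType} (T : R).
Hypothesis T_gt0 : 0 < T.
Local Notation mu := (@lebesgue_measure R).
Local Notation D := (`]0, T[%classic : set R).
Implicit Types (u v w phi psi : R -> R) (c M x : R).

Let mD : @measurable _ (measurableTypeR R) D := measurable_itv _.

Lemma Ccinfty_C0 v : Ccinfty T v -> C0 T v.
Proof.
move=> [dv _ sv]; split.
  move=> x; apply: differentiable_continuous; apply/derivable1_diffP.
  exact: (dv 0%N).
move=> x xD; apply/eqP; apply: contraNT xD => vx.
by apply: sv; exact: subset_closure.
Qed.

Lemma Ccinfty_derivable v x : Ccinfty T v -> derivable v x 1.
Proof. by move=> [dv _ _]; exact: (dv 0%N). Qed.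

Lemma Ccinfty_continuous_derive v : Ccinfty T v -> continuous v^`()%classic.
Proof.
move=> [dv _ _] x; apply: differentiable_continuous; apply/derivable1_diffP.
by have := dv 1%N x; rewrite derive1n1.
Qed.

Lemma Ccinfty_derive_bounded v : Ccinfty T v ->
  exists M, forall x, x \in `]0, T[ -> `|v^`()%classic x| <= M.
Proof.
move=> /Ccinfty_continuous_derive cv.
have [c _ hc] := @EVT_max R (fun x => `|v^`()%classic x|) 0 T (ltW T_gt0)
  (continuous_subspaceT (fun x => continuous_comp (cv x) (@norm_continuous _ R
    _))).
by exists `|v^`()%classic c| => x xD; apply: hc; exact: subset_itv_oo_cc.
Qed.

Lemma Rintegral_indic_tail x (f : R -> R) : 0 <= x -> continuous f ->
  \int[mu]_(t in D) (\1_(`]x, T[) t * f t) = \int[mu]_(t in `[x, T]) f t.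
Proof.
move=> x0 cf.
have ift : mu.-integrable `[x, T] (EFin \o f).
  apply: continuous_compact_integrable; first exact: segment_compact.
  exact: continuous_subspaceT.
have ifo : mu.-integrable `]x, T] (EFin \o f).
  apply: integrableS ift => //; exact: subset_itv_oc_cc.
have ifoo : mu.-integrable `]x, T[ (EFin \o f).
  apply: integrableS ift => //; exact: subset_itv_oo_cc.
rewrite -(Rintegral_itv_obnd_cbnd ifo) -(Rintegral_itv_bndo_bndc ifoo).
rewrite Rintegral_mkcond [RHS]Rintegral_mkcond; apply: eq_Rintegral => t _.
rewrite /patch; case: ifPn => tD.
  by rewrite indicE; case: ifPn => _; rewrite ?mul1r ?mul0r.
case: ifPn => // tx; move: tD; rewrite notin_setE/= in_itv/= => /negP.
move: tx; rewrite inE/= in_itv/= => /andP[xt ->].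
by rewrite andbT (le_lt_trans x0 xt).
Qed.

(** One integration by parts on [x, T] serves steps (c = 0, d = 1), ramps (c = 1, d = - x) and
    affine functions (x = 0). *)
Lemma Rintegral_affine_tail x c (d : R) v : 0 <= x < T -> Ccinfty T v ->
  \int[mu]_(t in D) (\1_(`]x, T[) t * (c * t + d) * v^`()%classic t) =
  - ((c * x + d) * v x) - c * \int[mu]_(t in D) (\1_(`]x, T[) t * v t).
Proof.
move=> /andP[x0 xT] Cv.
have [cv v0] := Ccinfty_C0 Cv.
have cv' := Ccinfty_continuous_derive Cv.
have caff : continuous (fun t : R => c * t + d).
  move=> t; apply: cvgD; last exact: cvg_cst.
  by apply: cvgMl_tmp; exact: cvg_id.
under eq_Rintegral do rewrite -mulrA.
rewrite Rintegral_indic_tail//; last first.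
  by move=> t; apply: cvgM; [exact: caff|exact: cv'].
have daff := is_derive_affine c d.
rewrite (@Rintegration_by_parts R (fun t => c * t + d) v (fun=>
  c) v^`()%classic)//.
- rewrite v0 ?mulr0 ?sub0r; last by rewrite in_itv/= ltxx andbF.
  congr (_ - _); rewrite Rintegral_indic_tail// RintegralZl//.
  apply: continuous_compact_integrable; first exact: segment_compact.
  exact: continuous_subspaceT.
- by apply: continuous_subspaceT => ?; exact: cvg_cst.
- split.
  + by move=> t _; have [] := daff t.
  + by apply: cvg_at_right_filter; exact: caff.
  + by apply: cvg_at_left_filter; exact: caff.
- by move=> t _; rewrite derive1E; have [_ ->] := daff t.
- exact: continuous_subspaceT.
- split.
  + by move=> t _; exact: Ccinfty_derivable.
  + by apply: cvg_at_right_filter; exact: cv.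
  + by apply: cvg_at_left_filter; exact: cv.
Qed.

Lemma dens_linear w : mu.-integrable D (EFin \o w) -> linear_on_C0 T (dens T w).
Proof.
move=> iw c phi psi Cphi Cpsi; rewrite /dens.
have [M _ hM] := C0_bounded Cphi.
have [M' _ hM'] := C0_bounded Cpsi.
have i1 := integrable_mul_bounded iw (C0_measurable Cphi) (fun x _ => hM x).
have i2 := integrable_mul_bounded iw (C0_measurable Cpsi) (fun x _ => hM' x).
rewrite -RintegralZl// -RintegralD//.
  by apply: eq_Rintegral => x _; rewrite -[(_ + _) x]/(c * phi x + psi x); ring.
rewrite (_ : _ \o _ = fun x : R => (c%:E * (EFin \o (fun x : R =>
  w x * phi x)%R) x)%E).
  exact: integrableZl.
by apply/funext => x /=; rewrite EFinM.
Qed.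

Lemma radon_dens w : mu.-integrable D (EFin \o w) -> radon T (dens T w).
Proof.
move=> iw; split; first exact: dens_linear.
apply: (@le_lt_trans _ _ (\int[mu]_(x in D) `|w x|)%:E); last exact: ltry.
apply: mnorm_le => phi Cphi phi1.
have := normr_Rintegral_mul_le iw (C0_measurable Cphi) (fun x _ => phi1 x).
by rewrite mul1r.
Qed.

Lemma radon_lin c m m' : radon T m -> radon T m' ->
  radon T (fun phi => c * m phi + m' phi).
Proof.
move=> [lm fm] [lm' fm']; split.
  by move=> a phi psi Cphi Cpsi; rewrite lm// lm'//; ring.
have [K K0 hK] := le_mnorm_fin lm fm.
have [K' K'0 hK'] := le_mnorm_fin lm' fm'.
apply: (@le_lt_trans _ _ (`|c| * K + K')%:E); last exact: ltry.
apply: mnorm_le => phi Cphi phi1; rewrite (le_trans (ler_normD _ _))//.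
apply: lerD; last by have := hK' _ _ Cphi ltr01 phi1; rewrite mulr1.
by rewrite normrM ler_wpM2l//; have := hK _ _ Cphi ltr01 phi1; rewrite mulr1.
Qed.

Lemma radon_eval x : radon T (fun phi => phi x).
Proof.
split; first by [].
apply: (@le_lt_trans _ _ 1%:E); last exact: ltry.
by apply: mnorm_le => phi _; exact.
Qed.

Lemma is_distr_deriv_lin c u u' m m' :
  mu.-integrable D (EFin \o u) -> mu.-integrable D (EFin \o u') ->
  is_distr_deriv T u m -> is_distr_deriv T u' m' ->
  is_distr_deriv T (fun x => c * u x + u' x) (fun phi => c * m phi + m' phi).
Proof.
move=> iu iu' [rm hm] [rm' hm']; split; first exact: radon_lin.
move=> v Cv; rewrite hm// hm'//.
have [M hM] := Ccinfty_derive_bounded Cv.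
have mv' := continuous_measurable_fun (Ccinfty_continuous_derive Cv).
have i1 := integrable_mul_bounded iu mv' hM.
have i2 := integrable_mul_bounded iu' mv' hM.
rewrite mulrN -opprD -RintegralZl// -RintegralD//.
  by congr (- _); apply: eq_Rintegral => x _; ring.
rewrite (_ : _ \o _ = fun x : R => (c%:E * (EFin \o (fun x : R =>
  u x * v^`()%classic x)%R) x)%E).
  exact: integrableZl.
by apply/funext => x /=; rewrite EFinM.
Qed.

Lemma eq_is_distr_deriv u u' m : {in `]0, T[, u =1 u'} ->
  is_distr_deriv T u m -> is_distr_deriv T u' m.
Proof.
move=> uu' [rm hm]; split => // v Cv; rewrite hm//; congr (- _).
by apply: eq_Rintegral => x; rewrite inE/= => xD; rewrite uu'.
Qed.

End DistributionalDerivatives.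

(* On (0, T), kink T x and rampf x differ by an affine function; rampf, contrary
   to kink, depends continuously on x. *)
Definition rampf {R : realType} (x : R) : R -> R := fun t => Num.max (t - x) 0.

(** * Upper bound for the TGV of a combination of steps and ramps *)

Section TGVUpperBound.
Context {R : realType} (T : R).
Hypothesis T_gt0 : 0 < T.
Local Notation mu := (@lebesgue_measure R).
Local Notation D := (`]0, T[%classic : set R).
Implicit Types (u v w phi psi : R -> R) (c M x : R).

Let mD : @measurable _ (measurableTypeR R) D := measurable_itv _.

Lemma integrable_of_bounded u M : measurable_fun setT u ->
  (forall x, x \in `]0, T[ -> `|u x| <= M) -> mu.-integrable D (EFin \o u).
Proof.
by move=> mu_ uM; apply/Lfun1_integrable0T/(Lfun_of_bounded (lexx 1) mu_ uM).
Qed.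

Lemma measurable_stepf x : measurable_fun setT (stepf T x).
Proof. exact: measurable_indic. Qed.

Lemma normr_stepf_le1 x t : `|stepf T x t| <= 1.
Proof.
by rewrite /stepf indicE; case: (_ \in _); rewrite ?normr1// normr0.
Qed.

Lemma stepfE x t : t \in `]0, T[ -> stepf T x t = (x < t)%R%:R.
Proof.
rewrite in_itv/= /stepf indicE => /andP[_ tT].
by rewrite mem_setE in_itv/= tT andbT.
Qed.

Lemma continuous_rampf x : continuous (rampf x).
Proof.
move=> t; apply: (@continuous_max R R (fun t => t - x) (fun=> 0)).
  by apply: cvgB; [exact: cvg_id|exact: cvg_cst].
exact: cvg_cst.
Qed.

Lemma normr_rampf_le x t : t \in `]0, T[ -> `|rampf x t| <= T + `|x|.
Proof.
rewrite in_itv/= /rampf => /andP[t0 tT].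
have := ler_norm (- x); rewrite normrN => ?.
have := normr_ge0 x => ?.
by rewrite ger0_norm ?le_max ?lexx ?orbT// ge_max; apply/andP; split; lra.
Qed.

Lemma integrable_stepf x : mu.-integrable D (EFin \o stepf T x).
Proof.
apply: (integrable_of_bounded (M := 1)); first exact: measurable_stepf.
by move=> t _; exact: normr_stepf_le1.
Qed.

Lemma integrable_rampf x : mu.-integrable D (EFin \o rampf x).
Proof.
apply: (integrable_of_bounded (M := T + `|x|)); last exact: normr_rampf_le.
by apply: continuous_measurable_fun; exact: continuous_rampf.
Qed.

Lemma measurable_affine (a b : R) : measurable_fun setT (fun t : R =>
  a * t + b).
Proof.
apply: continuous_measurable_fun => t; apply: cvgD; last exact: cvg_cst.
by apply: cvgMl_tmp; exact: cvg_id.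
Qed.

Lemma normr_affine_le (a b : R) t : t \in `]0, T[ ->
  `|a * t + b| <= `|a| * T + `|b|.
Proof.
rewrite in_itv/= => /andP[t0 tT]; rewrite (le_trans (ler_normD _ _))// lerD2r.
by rewrite normrM ler_wpM2l// ltW// gtr0_norm.
Qed.

Lemma integrable_affine (a b : R) : mu.-integrable D (EFin \o (fun t : R =>
  a * t + b)).
Proof.
apply: (integrable_of_bounded (M := `|a| * T + `|b|));
  first exact: measurable_affine.
by move=> x xD; exact: normr_affine_le.
Qed.

Lemma is_distr_deriv_stepf x : 0 <= x < T ->
  is_distr_deriv T (stepf T x) (fun phi => phi x).
Proof.
move=> xT; split; first exact: radon_eval.
move=> v Cv; have := @Rintegral_affine_tail _ T x 0 1 v xT Cv.
rewrite !mul0r add0r mul1r subr0 => h.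
rewrite -[LHS]opprK -h; congr (- _); apply: eq_Rintegral => t _.
by rewrite mul0r add0r mulr1.
Qed.

Lemma is_distr_deriv_rampf x : 0 <= x < T ->
  is_distr_deriv T (rampf x) (dens T (stepf T x)).
Proof.
move=> xT; split; first exact/radon_dens/integrable_stepf.
move=> v Cv; have := @Rintegral_affine_tail _ T x 1 (- x) v xT Cv.
rewrite !mul1r subrr mul0r oppr0 sub0r => h.
rewrite /dens -[LHS]opprK -h; congr (- _); apply: eq_Rintegral => t tD.
congr (_ * _); rewrite -/(stepf T x t) stepfE ?mul1r; last by move: tD;
  rewrite inE.
rewrite /rampf; case: ltP => xt; rewrite ?mul1r ?mul0r.
  by rewrite max_l// subr_ge0 ltW.
by rewrite max_r// subr_le0.
Qed.

Lemma is_distr_deriv_affine (a b : R) :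
  is_distr_deriv T (fun t => a * t + b) (dens T (fun=> a)).
Proof.
split.
  apply: radon_dens; apply: (integrable_of_bounded (M := `|a|)) => //.
move=> v Cv; have := @Rintegral_affine_tail _ T 0 a b v.
rewrite lexx T_gt0 => /(_ isT Cv).
have -> : v 0 = 0 by rewrite (Ccinfty_C0 Cv).2// in_itv/= ltxx.
rewrite mulr0 oppr0 sub0r => h.
have one t : t \in D -> \1_(`]0, T[) t = 1 :> R by move=> tD; rewrite indicE tD.
rewrite /dens RintegralZl//; last first.
  have [M _ hM] := C0_bounded (Ccinfty_C0 Cv).
  apply: (integrable_of_bounded (M := M)) => //.
  by apply: (@C0_measurable _ T); exact: Ccinfty_C0.
rewrite -[LHS]opprK; congr (- _).
have -> : \int[mu]_(t in D) ((a * t + b) * v^`()%classic t) =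
    \int[mu]_(t in D) (\1_(`]0, T[) t * (a * t + b) * v^`()%classic t).
  by apply: eq_Rintegral => t tD; rewrite one// mul1r.
rewrite h; congr (- (_ * _)); apply: eq_Rintegral => t tD.
by rewrite one// mul1r.
Qed.

Section FiniteSums.
Context {I : finType} (c : I -> R) (u : I -> R -> R).
Hypothesis iu : forall i, mu.-integrable D (EFin \o u i).

Lemma integrable_lin a u1 u2 : mu.-integrable D (EFin \o u1) ->
  mu.-integrable D (EFin \o u2) ->
  mu.-integrable D (EFin \o (fun t => a * u1 t + u2 t)).
Proof.
move=> i1 i2.
rewrite (_ : _ \o _ = (fun t : R => a%:E * (EFin \o u1) t) \+ (EFin \o u2))%E.
  by apply: integrableD => //; exact: integrableZl.
by apply/funext => t /=; rewrite EFinD EFinM.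
Qed.

(** Function and functional are unfolded together, so that a single induction serves integrability,
    derivatives and densities. *)
Let lincomb_ind (m : I -> (R -> R) -> R) (P : (R -> R) -> ((R -> R) -> R) ->
  Prop) :
  P (fun=> 0) (fun=> 0) ->
  (forall i f m', P f m' -> P (fun t => c i * u i t + f t)
                              (fun phi => c i * m i phi + m' phi)) ->
  P (fun t => \sum_i c i * u i t) (fun phi => \sum_i c i * m i phi).
Proof.
move=> P0 PS; elim: (index_enum I) => [|i s IHs].
  under eq_fun do rewrite big_nil.
  by under [X in P _ X]eq_fun do rewrite big_nil.
under eq_fun do rewrite big_cons.
by under [X in P _ X]eq_fun do rewrite big_cons; exact: PS.
Qed.

Lemma integrable_lincomb : mu.-integrable D (EFin \o (fun t =>
  \sum_i c i * u i t)).
Proof.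
apply: (@lincomb_ind (fun _ _ => 0) (fun f _ => mu.-integrable D (EFin \o f))).
  by apply: (integrable_of_bounded (M := 0)) => // t _; rewrite normr0.
by move=> i f _; exact: integrable_lin.
Qed.

Lemma is_distr_deriv_lincomb (m : I -> (R -> R) -> R) : (forall i,
  is_distr_deriv T (u i) (m i)) ->
  is_distr_deriv T (fun t => \sum_i c i * u i t) (fun phi =>
    \sum_i c i * m i phi).
Proof.
move=> hm; apply: (proj2 (@lincomb_ind m (fun f m' =>
  mu.-integrable D (EFin \o f) /\ is_distr_deriv T f m') _ _)).
  have i0 : mu.-integrable D (EFin \o (fun=> 0 : R)).
    by apply: (integrable_of_bounded (M := 0)) => // t _; rewrite normr0.
  split => //; split; first split.
  - by move=> a phi psi _ _; rewrite mulr0 addr0.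
  - apply: (@le_lt_trans _ _ 0%:E); last exact: ltry.
    by apply: mnorm_le => phi _ _; rewrite normr0.
  - move=> v _; under eq_Rintegral do rewrite mul0r.
    by rewrite Rintegral_cst ?mul0r ?oppr0.
move=> i f m' [i_f df]; split; first exact: integrable_lin.
exact: is_distr_deriv_lin.
Qed.

Lemma dens_lin a u1 u2 phi : mu.-integrable D (EFin \o u1) ->
  mu.-integrable D (EFin \o u2) -> C0 T phi ->
  dens T (fun t => a * u1 t + u2 t) phi = a * dens T u1 phi + dens T u2 phi.
Proof.
move=> i1 i2 Cphi; have [M _ hM] := C0_bounded Cphi.
have mphi := C0_measurable Cphi.
have p1 := integrable_mul_bounded i1 mphi (fun x _ => hM x).
have p2 := integrable_mul_bounded i2 mphi (fun x _ => hM x).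
rewrite /dens -RintegralZl// -RintegralD//.
  by apply: eq_Rintegral => t _; ring.
rewrite (_ : _ \o _ = fun x : R => (a%:E * (EFin \o (fun x : R =>
  u1 x * phi x)%R) x)%E).
  exact: integrableZl.
by apply/funext => x /=; rewrite EFinM.
Qed.

Lemma dens_lincomb phi : C0 T phi ->
  dens T (fun t => \sum_i c i * u i t) phi = \sum_i c i * dens T (u i) phi.
Proof.
move=> Cphi; apply: (proj2 (@lincomb_ind (fun i => dens T (u i)) (fun f m' =>
  mu.-integrable D (EFin \o f) /\ dens T f phi = m' phi) _ _)).
  split; first by apply: (integrable_of_bounded (M := 0)) => // t _;
    rewrite normr0.
  by rewrite /dens; under eq_Rintegral do rewrite mul0r;
    rewrite Rintegral_cst ?mul0r.
by move=> i f m' [i_f df]; split; [exact: integrable_lin|rewrite dens_lin// df].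
Qed.

End FiniteSums.

(** The competitor [w] is the slope of the ramps and of the affine part. Then Du - w consists of
    point masses at the steps and Dw of point masses at the kinks; the factors 1/alpha and 1/beta
    cancel the weights of the TGV. *)
Lemma TGV_le (alpha beta : R) (I J : finType) (xS cS : I -> R) (xK cK : J -> R)
    (a b : R) u : 0 < alpha -> 0 < beta ->
  (forall i, xS i \in `]0, T[) -> (forall j, xK j \in `]0, T[) ->
  (forall t, t \in `]0, T[ -> u t =
    alpha^-1 * (\sum_i cS i * stepf T (xS i) t) +
    (beta^-1 * (\sum_j cK j * rampf (xK j) t) + (a * t + b))) ->
  (exists m, is_distr_deriv T u m) /\
  (TGV T alpha beta u <= (\sum_i `|cS i| + \sum_j `|cK j|)%:E)%E.
Proof.
move=> alpha0 beta0 xSD xKD uE.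
have in0T x : x \in `]0, T[ -> 0 <= x < T.
  by rewrite in_itv/= => /andP[/ltW -> ->].
pose w t := beta^-1 * (\sum_j cK j * stepf T (xK j) t) + a.
have iS := integrable_lincomb cS (fun i => integrable_stepf (xS i)).
have iK := integrable_lincomb cK (fun j => integrable_stepf (xK j)).
have iR := integrable_lincomb cK (fun j => integrable_rampf (xK j)).
have ia : mu.-integrable D (EFin \o (fun=> a)).
  by apply: (integrable_of_bounded (M := `|a|)).
have iw : mu.-integrable D (EFin \o w) by exact: integrable_lin.
(* The zero density is the derivative of the constant [a], obtained from the rule for affine
   functions. *)
pose Dw phi := beta^-1 * (\sum_j cK j * phi (xK j)) + dens T (fun=> 0) phi.
have dw : is_distr_deriv T w Dw.
  apply: (eq_is_distr_deriv (u := fun t =>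
    beta^-1 * (\sum_j cK j * stepf T (xK j) t) + (0 * t + a))).
    by move=> t tD; rewrite mul0r add0r.
  apply: is_distr_deriv_lin => //; first exact: integrable_affine.
    apply: (is_distr_deriv_lincomb _ (fun j => integrable_stepf (xK j))) => i.
    apply: is_distr_deriv_stepf; exact: in0T.
  exact: is_distr_deriv_affine.
have mw : measurable_fun setT w.
  apply: measurable_funD => //; apply: measurable_funM => //.
  apply: measurable_sum => j; apply: measurable_funM => //.
  exact: measurable_stepf.
pose Du phi := alpha^-1 * (\sum_i cS i * phi (xS i)) +
  (beta^-1 * (\sum_j cK j * dens T (stepf T (xK j)) phi) + dens T (fun=>
    a) phi).
have du : is_distr_deriv T u Du.
  apply: (eq_is_distr_deriv (u := fun t => alpha^-1 * (\sum_i cS i * stepf T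
    (xS i) t) +
    (beta^-1 * (\sum_j cK j * rampf (xK j) t) + (a * t + b)))).
    by move=> t tD; rewrite uE.
  apply: is_distr_deriv_lin => //.
  - by apply: integrable_lin => //; exact: integrable_affine.
  - apply: (is_distr_deriv_lincomb _ (fun i => integrable_stepf (xS i))) => i.
    by apply: is_distr_deriv_stepf; exact: in0T.
  - apply: is_distr_deriv_lin => //; first exact: integrable_affine.
    + apply: (is_distr_deriv_lincomb _ (fun j => integrable_rampf (xK j))) => i.
      by apply: is_distr_deriv_rampf; exact: in0T.
    + exact: is_distr_deriv_affine.
split; first by exists Du.
apply: (@le_trans _ _ (alpha%:E * mnorm T (fun phi => Du phi - dens T w phi)%R +
   beta%:E * mnorm T Dw)%E).
  apply: ereal_inf_lbound; exists w, Du, Dw; split => //.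
  split; last by exists Dw.
  apply: (Lfun_of_bounded (M := beta^-1 * (\sum_j `|cK j|) + `|a|)) => // t _.
  rewrite (le_trans (ler_normD _ _))// lerD2r normrM gtr0_norm ?invr_gt0//.
  rewrite ler_pM2l ?invr_gt0// (le_trans (ler_norm_sum _ _ _))//.
  by apply: ler_sum => j _; rewrite normrM ler_piMr// normr_stepf_le1.
have sum_bound (L : finType) (c x : L -> R) phi : (forall x, `|phi x| <= 1) ->
    `|\sum_l c l * phi (x l)| <= \sum_l `|c l|.
  move=> phi1; apply: (le_trans (ler_norm_sum _ _ _)).
  by apply: ler_sum => l _; rewrite normrM ler_piMr.
rewrite EFinD; apply: leeD.
- rewrite -lee_pdivlMl// -EFinM; apply: mnorm_le => phi Cphi phi1.
  have -> : Du phi - dens T w phi = alpha^-1 * (\sum_i cS i * phi (xS i)).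
    rewrite /Du /w dens_lin//.
    by rewrite (dens_lincomb _ (fun j => integrable_stepf (xK j)) Cphi) addrK.
  by rewrite normrM gtr0_norm ?invr_gt0// ler_pM2l ?invr_gt0// sum_bound.
- rewrite -lee_pdivlMl// -EFinM; apply: mnorm_le => phi Cphi phi1.
  have -> : Dw phi = beta^-1 * (\sum_j cK j * phi (xK j)).
    rewrite /Dw /dens; under eq_Rintegral do rewrite mul0r.
    by rewrite Rintegral_cst// mul0r addr0.
  by rewrite normrM gtr0_norm ?invr_gt0// ler_pM2l ?invr_gt0// sum_bound.
Qed.

End TGVUpperBound.

(** * Piecewise affine test functions *)

(** The hat centred at [c] with half-width and height [h]. As a second difference of ramps, it has
    the second difference of steps as its derivative. *)
Definition tentf {R : realType} (c h x : R) : R :=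
  rampf (c - h) x - 2 * rampf c x + rampf (c + h) x.

Section TentFunctions.
Context {R : realType} (T : R).
Hypothesis T_gt0 : 0 < T.
Local Notation mu := (@lebesgue_measure R).
Local Notation D := (`]0, T[%classic : set R).
Implicit Types (u v w phi psi : R -> R) (c h x y : R).

Let mD : @measurable _ (measurableTypeR R) D := measurable_itv _.

Lemma rampfE c x : rampf c x = if c <= x then x - c else 0.
Proof.
rewrite /rampf; case: leP => [cx|/ltW cx]; first by rewrite max_l// subr_ge0.
by rewrite max_r// subr_le0.
Qed.

Lemma tentf_ge0 c h x : 0 < h -> 0 <= tentf c h x.
Proof.
move=> h0; rewrite /tentf !rampfE.
by case: (leP (c - h) x); case: (leP c x); case: (leP (c + h) x); lra.
Qed.

Lemma tentf_eq0 c h x : 0 < h -> h <= `|x - c| -> tentf c h x = 0.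
Proof.
move=> h0; rewrite ler_normr => /orP[?|?];
  rewrite /tentf !rampfE;
  by case: (leP (c - h) x); case: (leP c x); case: (leP (c + h) x); lra.
Qed.

Lemma continuous_tentf c h : continuous (tentf c h).
Proof.
move=> x; apply: cvgD; last exact: continuous_rampf.
apply: cvgB; first exact: continuous_rampf.
by apply: cvgMl_tmp; exact: continuous_rampf.
Qed.

Lemma C0_tentf c h : 0 < h -> 0 <= c - h -> c + h <= T -> C0 T (tentf c h).
Proof.
move=> h0 hc hT; split; first exact: continuous_tentf.
move=> x; rewrite in_itv/= negb_and -!leNgt => /orP[?|?];
  apply: tentf_eq0 => //.
  by rewrite ler_normr; apply/orP; right; lra.
by rewrite ler_normr; apply/orP; left; lra.
Qed.

(** A tent is not smooth, so it is approximated by combinations of rescaled smooth ramps. The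
    left-hand side converges because [m] is bounded and the approximation uniform, the right-hand
    side by dominated convergence of the derivatives. *)
Lemma is_distr_deriv_tentf u m c h : mu.-integrable D (EFin \o u) ->
  is_distr_deriv T u m -> 0 < h -> 0 <= c - h -> c + h <= T ->
  m (tentf c h) = - \int[mu]_(x in D)
    (u x * (stepf T (c - h) x - 2 * stepf T c x + stepf T (c + h) x)).
Proof.
move=> iu [[lm fm] hm] h0 hc hT.
have [E [dE [C [eE edE dEE [E0 E1 Er [dEC dE0 dE1]]]]]] := @smooth_ramp R.
have [K K0 hK] := le_mnorm_fin lm fm.
have cdE := elementary_continuous edE.
have dE00 : dE 0 = 0.
  have l : dE x @[x --> 0^'-] --> dE 0 by apply: cvg_at_left_filter; exact: cdE.
  have l0 : dE x @[x --> (0:R)^'-] --> (0:R).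
    apply: cvg_near_cst; near=> x; apply: dE0; near: x; exact: nbhs_left_lt.
  exact: (cvg_unique _ l l0).
have dE0' x : x <= 0 -> dE x = 0.
  by rewrite le_eqVlt => /predU1P[->//|/dE0].
(* At most h / 4, so that the transition zones of the three smoothed ramps are disjoint. *)
pose e n : R := h / 4 * harmonic n.
have e0 n : 0 < e n by rewrite mulr_gt0// ?divr_gt0// invr_gt0.
have eh n : e n <= h / 4.
  by rewrite ger_pMr ?divr_gt0// invf_le1// ler1n.
pose Ee n a x := e n * E ((e n)^-1 * x + - ((e n)^-1 * a)).
pose dEe n a x := dE ((e n)^-1 * x + - ((e n)^-1 * a)).
have eEe n a : elementary (Ee n a).
  by apply: elementary_mul; [exact: elementary_cst|exact: elementary_affine].
have dEeE n a x : is_derive x 1 (Ee n a) (dEe n a x).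
  have h1 := @is_derive1_comp R E (fun y => (e n)^-1 * y + - ((e n)^-1 * a)) x
    _ _
    (dEE _) (is_derive_affine (e n)^-1 (- ((e n)^-1 * a)) x).
  apply: (is_derive_eq (is_deriveZ (e n) h1)).
  by rewrite /GRing.scale/= mulrC divfK ?gt_eqF.
have scaleE n a x : (e n)^-1 * x + - ((e n)^-1 * a) = (x - a) / e n.
  by rewrite -mulrBr mulrC.
have Ee0 n a x : x <= a -> Ee n a x = 0.
  move=> xa; rewrite /Ee scaleE E0 ?mulr0//.
  by rewrite ler_pdivrMr// mul0r subr_le0.
have Ee1 n a x : a + e n <= x -> Ee n a x = x - a.
  move=> xa; rewrite /Ee scaleE E1; first by rewrite mulrC divfK// gt_eqF.
  by rewrite ler_pdivlMr// mul1r lerBrDl.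
have Eer n a x : `|Ee n a x - rampf a x| <= e n.
  have -> : rampf a x = e n * Num.max ((x - a) / e n) 0.
    by rewrite maxr_pMr ?(ltW (e0 n))// mulr0 mulrC divfK// gt_eqF.
  rewrite /Ee scaleE -mulrBr normrM (gtr0_norm (e0 n)).
  by rewrite ler_piMr ?(ltW (e0 n)).
(* Moving the outer nodes inwards by 2 e keeps the support in (0, T) even when
   c - h = 0 or c + h = T, and the tent remains balanced. *)
pose tau n x := Ee n (c - h + 2 * e n) x + - 2 * Ee n c x + Ee n (c + h - 2 * e
  n) x.
pose dtau n x := dEe n (c - h + 2 * e n) x + - 2 * dEe n c x + dEe n (c + h -
  2 * e n) x.
have etau n : elementary (tau n).
  apply: elementary_add => //; apply: elementary_add => //.
  by apply: elementary_mul => //; exact: elementary_cst.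
have dtauE n x : is_derive x 1 (tau n) (dtau n x).
  exact: (is_deriveD (is_deriveD (dEeE n _ x) (is_deriveZ (- 2) (dEeE n c x)))
    (dEeE n _ x)).
have tau'E n : (tau n)^`()%classic = dtau n.
  by apply/funext => x; rewrite derive1E; have [_ ->] := dtauE n x.
have Ctau n : Ccinfty T (tau n).
  have := e0 n; have := eh n => en0 en1.
  pose B := [set` `[c - h + 2 * e n, c + h - e n]].
  have sB : [set x | tau n x != 0] `<=` B.
    move=> x /= tx; rewrite /B/= in_itv/= !leNgt -negb_or;
      apply: contra tx => /orP[xl|xr].
      by rewrite /tau !Ee0 ?mulr0 ?addr0//; lra.
    by rewrite /tau !Ee1; [apply/eqP; lra|lra|lra|lra].
  have cB : closure [set x | tau n x != 0] `<=` B.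
    rewrite [X in _ `<=` X](closure_id B).1; first exact: closure_subset.
    exact: itv_closed.
  split.
  - by move=> k x; exact: elementary_smooth.
  - by apply: subclosed_compact cB; [exact: closed_closure|exact:
      segment_compact].
  - apply: (subset_trans cB) => x; rewrite /B/= !in_itv/= => /andP[? ?].
    by apply/andP; split; lra.
have mtau n : m (tau n) = - \int[mu]_(x in D) (u x * dtau n x).
  by rewrite hm// tau'E.
have C0tent := C0_tentf h0 hc hT.
have e_cvg : e n @[n --> \oo] --> (0 : R).
  by rewrite -(mulr0 (h / 4)); apply: cvgMl_tmp; exact: cvg_harmonic.
(* The three smoothings, weighted 1, 2, 1, contribute 4 e, and each of the two displaced nodes 2
   e. *)
have taur n x : `|tau n x - tentf c h x| <= 8 * e n.
  have lip a b : `|rampf a x - rampf b x| <= `|a - b|.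
    have h1 := ler_norm (a - b); have h2 := ler_norm (b - a).
    rewrite distrC in h2; rewrite !rampfE ler_norml.
    by case: (leP a x); case: (leP b x) => ? ?; apply/andP; split; lra.
  have := Eer n (c - h + 2 * e n) x; have := Eer n c x.
  have := Eer n (c + h - 2 * e n) x.
  have := lip (c - h + 2 * e n) (c - h); have := lip (c + h - 2 * e n) (c + h).
  rewrite (_ : _ - (c + h) = - (2 * e n)); last by ring.
  rewrite (_ : _ - (c - h) = 2 * e n); last by ring.
  rewrite normrN (ger0_norm (_ : 0 <= 2 * e n)); last by rewrite mulr_ge0// ltW.
  rewrite /tau /tentf !ler_norml.
  move=> /andP[? ?] /andP[? ?] /andP[? ?] /andP[? ?] /andP[? ?].
  by apply/andP; split; lra.
have Ke_cvg : K * (8 * e n) @[n --> \oo] --> (0 : R).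
  rewrite -(mulr0 K) -(mulr0 8).
  by apply: cvgMl_tmp; apply: cvgMl_tmp.
have lim1 : m (tau n) @[n --> \oo] --> m (tentf c h).
  apply/cvgrPdist_le => d d0; near=> n.
  have C0tau := Ccinfty_C0 (Ctau n).
  have -> : m (tentf c h) - m (tau n) = m (- 1 *: tau n + tentf c h).
    by rewrite lm// mulN1r addrC.
  apply: (@le_trans _ _ (K * (8 * e n))).
    apply: hK; [exact: C0_lin|by rewrite mulr_gt0|move=> x].
    rewrite -[X in `|X|]/(- 1 * tau n x + tentf c h x).
    by rewrite mulN1r addrC distrC.
  by near: n; exact: (cvgr_le _ Ke_cvg).
have lim2 : (\int[mu]_(x in D) (u x * dtau n x)) @[n --> \oo] -->
   \int[mu]_(x in D) (u x * (stepf T (c - h) x - 2 * stepf T c x + stepf T (c +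
     h) x)).
  pose g x := u x * (stepf T (c - h) x - 2 * stepf T c x + stepf T (c + h) x).
  have C_ge0 : 0 <= C by apply: (le_trans _ (dEC 0)).
  have mdtau n : measurable_fun setT (dtau n).
    apply: continuous_measurable_fun => x.
    have cdEe a : {for x, continuous (dEe n a)}.
      exact: (elementary_continuous
        (elementary_affine (e n)^-1 (- ((e n)^-1 * a)) edE)).
    apply: cvgD; last exact: cdEe.
    by apply: cvgD; [exact: cdEe|apply: cvgMl_tmp; exact: cdEe].
  have dtau4 n x : x \in `]0, T[ -> `|dtau n x| <= 4 * C.
    move=> _; rewrite /dtau /dEe.
    have := dEC ((e n)^-1 * x + - ((e n)^-1 * (c - h + 2 * e n))).
    have := dEC ((e n)^-1 * x + - ((e n)^-1 * c)).
    have := dEC ((e n)^-1 * x + - ((e n)^-1 * (c + h - 2 * e n))).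
    rewrite !ler_norml => /andP[? ?] /andP[? ?] /andP[? ?].
    by apply/andP; split; lra.
  have iud n := integrable_mul_bounded iu (mdtau n) (dtau4 n).
  have iug : mu.-integrable D (EFin \o g).
    apply: (integrable_mul_bounded (M := 4) iu).
      apply: measurable_funD; last exact: measurable_stepf.
      apply: measurable_funB; first exact: measurable_stepf.
      by apply: measurable_funM => //; exact: measurable_stepf.
    move=> x _; have := normr_stepf_le1 T (c - h) x.
    have := normr_stepf_le1 T c x; have := normr_stepf_le1 T (c + h) x.
    rewrite !ler_norml => /andP[? ?] /andP[? ?] /andP[? ?].
    by apply/andP; split; lra.
  have iau : mu.-integrable D (fun x => (`|u x| * (4 * C))%:E).
    have iu' : mu.-integrable D (EFin \o (fun x => `|u x|)).
      exact: (integrable_norm iu).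
    apply: (integrable_mul_bounded (M := 4 * C) iu') => // x _.
    by rewrite ger0_norm// mulr_ge0.
  have [] := @dominated_convergence _ _ _ mu D mD (fun n x =>
    (u x * dtau n x)%:E)
    (EFin \o g) (fun x => (`|u x| * (4 * C))%:E).
  - by move=> n; exact: (measurable_int _ (iud n)).
  - exact: (measurable_int _ iug).
  (* At [c + h] the displaced node lies on the left, so the smoothed step tends to 1 while the step
     is 0. At [c] there is no such defect, since [dE 0 = 0]. *)
  - exists [set c + h]; split; [exact: measurable_set1|exact:
      lebesgue_measure_set1|].
    move=> x /= /not_implyP[xD ncvg]; apply: contrapT => /eqP xch; apply: ncvg.
    apply: cvg_EFin; first by near=> n.
    apply: cvgMl_tmp; apply: cvg_near_cst.
    have small d : 0 < d -> \forall n \near \oo, 4 * e n < d.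
      move=> d0; have e4 : 4 * e n @[n --> \oo] --> (0 : R).
        by rewrite -(mulr0 4); apply: cvgMl_tmp.
      exact: (cvgr_lt _ e4).
    have dEe0 n a : x <= a -> dEe n a x = 0.
      by move=> xa; rewrite /dEe scaleE dE0'// ler_pdivrMr// mul0r subr_le0.
    have dEe1 n a : a + e n < x -> dEe n a x = 1.
      by move=> xa; rewrite /dEe scaleE dE1// ltr_pdivlMr// mul1r ltrBrDl.
    have n1 : \forall n \near \oo, dEe n (c - h + 2 * e n) x = (c - h < x)%R%:R.
      have [hx|hx] := ltP (c - h) x; last first.
        by near=> n; rewrite dEe0// (le_trans hx)// lerDl mulr_ge0// ltW.
      near=> n; rewrite dEe1//; have : 4 * e n < x - (c - h).
        by near: n; apply: small; rewrite subr_gt0.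
      by have := e0 n; lra.
    have n2 : \forall n \near \oo, dEe n c x = (c < x)%R%:R.
      have [hx|hx] := ltP c x; last by near=> n; rewrite dEe0.
      near=> n; rewrite dEe1//; have : 4 * e n < x - c.
        by near: n; apply: small; rewrite subr_gt0.
      by have := e0 n; lra.
    have n3 : \forall n \near \oo, dEe n (c + h - 2 * e n) x = (c + h < x)%R%:R.
      have [hx|hx|hx] := ltgtP (c + h) x; last by rewrite hx eqxx in xch.
        by near=> n; rewrite dEe1//; have := e0 n; lra.
      near=> n; rewrite dEe0//; have : 4 * e n < c + h - x.
        by near: n; apply: small; rewrite subr_gt0.
      by have := e0 n; lra.
    near=> n; rewrite !stepfE// /dtau (near n1)// (near n2)// (near n3)//.
    by rewrite mulNr.
  - exact: iau.
  - by apply: aeW => x n xD; rewrite lee_fin normrM ler_wpM2l// dtau4.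
  move=> _ _ hlim.
  apply: fine_cvg; rewrite fineK//.
  exact: integrable_fin_num.
apply: (cvg_unique _ lim1) => //.
rewrite (_ : (fun n => m (tau n)) = fun n => - \int[mu]_(x in D) (u x * dtau n
  x)).
  exact: cvgN.
by apply/funext => n.
Unshelve. all: by end_near.
Qed.

End TentFunctions.

Definition uniformly_continuous {R : realType} (f : R -> R) := forall e : R,
  0 < e ->
  exists2 d : R, 0 < d & forall x y, `|x - y| < d -> `|f x - f y| <= e.

(** * Uniform grids and nodal interpolation *)

Section Grid.
Context {R : realType} (T : R).
Hypothesis T_gt0 : 0 < T.
Local Notation mu := (@lebesgue_measure R).
Local Notation D := (`]0, T[%classic : set R).
Variable N : nat.
Implicit Types (u v w phi psi : R -> R) (x : R) (y : nat -> R).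

Let mD : @measurable _ (measurableTypeR R) D := measurable_itv _.

Definition mesh : R := T / N.+1%:R.
Definition node (i : nat) : R := i%:R * mesh.
Local Notation h := mesh.

Lemma mesh_gt0 : 0 < h. Proof. by rewrite divr_gt0. Qed.

Lemma node0 : node 0 = 0. Proof. by rewrite /node mul0r. Qed.

Lemma nodeN : node N.+1 = T.
Proof. by rewrite /node mulrC divfK. Qed.

Lemma nodeS i : node i.+1 = node i + h.
Proof. by rewrite /node -natr1 mulrDl mul1r. Qed.

Lemma node_le i j : (i <= j)%N -> node i <= node j.
Proof. by move=> ij; rewrite ler_pM2r ?mesh_gt0// ler_nat. Qed.

(** On (0, T), the indicator of a cell open on the left. The form as a difference of steps lets a
    linear functional be evaluated on it from its values on steps. *)
Definition cellf (i : nat) x := stepf T (node i) x - stepf T (node i.+1) x.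

Lemma cellfE i x : x \in `]0, T[ -> cellf i x = (node i < x <= node i.+1)%R%:R.
Proof.
move=> xD; rewrite /cellf !stepfE//.
have := node_le (leqnSn i); case: (ltP (node i) x) => h1;
  case: (ltP (node i.+1) x) => h2 h3;
  rewrite ?subrr ?subr0//=; lra.
Qed.

Lemma cell_of x : x \in `]0, T[ -> exists2 k : nat, (k < N.+1)%N &
  node k < x <= node k.+1.
Proof.
rewrite in_itv/= => /andP[x0 xT].
have : x <= node N.+1 by rewrite nodeN ltW.
elim: N.+1 => [|m IH xm]; first by rewrite node0 leNgt x0.
have [xm'|xm'] := leP x (node m); last by exists m; rewrite ?xm'.
by have [k km hk] := IH xm'; exists k => //; exact: ltnW.
Qed.

Lemma sum_cellf (f : nat -> R) x k : x \in `]0, T[ -> (k < N.+1)%N ->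
  node k < x <= node k.+1 -> \sum_(i < N.+1) f i * cellf i x = f k.
Proof.
move=> xD kN hk; rewrite (bigD1 (Ordinal kN))//= cellfE// hk mulr1 big1
  ?addr0//.
move=> i ik; rewrite cellfE//; case: andP => [[h1 h2]|_]; last by rewrite mulr0.
have {ik} : (i : nat) != k by apply: contraNneq ik => ik; apply/eqP/val_inj.
case: ltngtP => // ik _; move: hk => /andP[h3 h4].
  by have := node_le ik; lra.
by have := node_le ik; lra.
Qed.

Definition tail_int u (i : nat) : R := \int[mu]_(x in D) (u x * stepf T (node
  i) x).
Definition cell_int u (i : nat) : R := tail_int u i - tail_int u i.+1.

Lemma integrable_mul_stepf u a : mu.-integrable D (EFin \o u) ->
  mu.-integrable D (EFin \o (fun x => u x * stepf T a x)).
Proof.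
move=> iu; apply: (integrable_mul_bounded (M := 1) iu);
  first exact: measurable_stepf.
by move=> x _; exact: normr_stepf_le1.
Qed.

(* Piecewise affine interpolation of y at the nodes, the values at the two end
   nodes being taken to be 0 whatever y is. *)
Definition pl y x := h^-1 * \sum_(i < N) y i.+1 * tentf (node i.+1) h x.

Lemma node_bounds i : (i < N)%N -> 0 <= node i.+1 - h /\ node i.+1 + h <= T.
Proof.
move=> iN; rewrite -nodeS nodeS addrK -nodeN; split; last exact: node_le.
by rewrite -node0; exact: node_le.
Qed.

Lemma C0_node_tentf (i : 'I_N) : C0 T (tentf (node i.+1) h).
Proof.
by have [? ?] := node_bounds (ltn_ord i); apply: C0_tentf => //;
  exact: mesh_gt0.
Qed.

Lemma linear_on_C0_sum m (I : Type) (s : seq I) (c : I -> R) (f : I -> R -> R) :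
  linear_on_C0 T m -> (forall i, C0 T (f i)) ->
  C0 T (fun x => \sum_(i <- s) c i * f i x) /\
  m (fun x => \sum_(i <- s) c i * f i x) = \sum_(i <- s) c i * m (f i).
Proof.
move=> lm Cf; elim: s => [|i s [C1 m1]].
  under eq_fun do rewrite big_nil; rewrite big_nil.
  by split; [exact: C0_cst0|exact: (linear_on_C0_0 lm)].
have -> : (fun x => \sum_(j <- i :: s) c j * f j x) =
    c i *: f i + (fun x => \sum_(j <- s) c j * f j x).
  by apply/funext => x; rewrite big_cons.
by split; [exact: C0_lin|rewrite lm// m1 big_cons].
Qed.

Lemma C0_pl y : C0 T (pl y).
Proof.
have [|C1 _] := @linear_on_C0_sum (fun=> 0) _ (index_enum 'I_N) (fun i =>
  y i.+1)
  (fun i => tentf (node i.+1) h) _ C0_node_tentf.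
  by move=> *; rewrite mulr0 addr0.
have := C0_lin h^-1 C1 (C0_cst0 T).
rewrite (_ : _ *: _ + cst 0 = pl y)//.
by apply/funext => x; rewrite -[LHS]/(h^-1 * _ + 0) addr0.
Qed.

(** Each tent yields the difference of two consecutive cell integrals; summation by parts moves the
    difference onto [y], whose end values vanish. *)
Lemma is_distr_deriv_pl u m y : mu.-integrable D (EFin \o u) ->
  is_distr_deriv T u m -> y 0%N = 0 -> y N.+1 = 0 ->
  m (pl y) = h^-1 * \sum_(i < N.+1) (y i - y i.+1) * cell_int u i.
Proof.
move=> iu um y0 yN; have lm : linear_on_C0 T m := um.1.1.
have [C1 mE] := @linear_on_C0_sum m _ (index_enum 'I_N) (fun i => y i.+1)
  (fun i => tentf (node i.+1) h) lm C0_node_tentf.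
rewrite (_ : pl y = h^-1 *: (fun x => \sum_(i < N) y i.+1 * tentf (node i.+1) h
  x))//.
rewrite (linear_on_C0Z _ lm C1) mE; congr (_ * _).
have tE (i : 'I_N) : m (tentf (node i.+1) h) = cell_int u i.+1 - cell_int u i.
  have [? ?] := node_bounds (ltn_ord i).
  rewrite (is_distr_deriv_tentf iu um mesh_gt0)// -[node i.+1 + h]nodeS.
  rewrite [node i.+1 - h](_ : _ = node i); last by rewrite nodeS addrK.
  have i1 := integrable_mul_stepf (node i) iu.
  have i2 := integrable_mul_stepf (node i.+1) iu.
  have i3 := integrable_mul_stepf (node i.+2) iu.
  rewrite /cell_int /tail_int.
  rewrite (_ : \int[mu]_(x in D) _ = - 2 * tail_int u i.+1 +
     (tail_int u i + tail_int u i.+2)); first by rewrite /tail_int; ring.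
  rewrite /tail_int -RintegralD// -RintegralZl// -RintegralD//.
  - by apply: eq_Rintegral => x _; ring.
  - exact: (integrableZl mD (- 2) i2).
  - exact: (integrableD mD i1 i3).
under eq_bigr do rewrite tE mulrBr; under [RHS]eq_bigr do rewrite mulrBl.
rewrite !sumrB big_ord_recl/= y0 mul0r add0r [in RHS]big_ord_recr/= yN mul0r
  addr0.
by congr (_ - _); apply: eq_bigr => i _; rewrite /bump.
Qed.

(** Tents at all nodes, ends included, divided by [h] form a partition of unity: each is a
    difference of consecutive [G], and the sum telescopes. *)
Lemma sum_tentf x : 0 <= x <= T -> \sum_(i < N.+2) tentf (node i) h x = h.
Proof.
move=> /andP[x0 xT].
pose G i := rampf (node i - h) x - rampf (node i) x.
have tG i : tentf (node i) h x = G i - G i.+1.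
  by rewrite /G /tentf nodeS addrK; ring.
under eq_bigr do rewrite tG.
have -> : \sum_(i < N.+2) (G i - G i.+1) = G 0%N - G N.+2.
  elim: N.+2 => [|k IH]; first by rewrite big_ord0 subrr.
  by rewrite big_ord_recr/= IH; ring.
have h0 := mesh_gt0.
rewrite /G node0 sub0r nodeS addrK nodeN !rampfE.
by case: (leP (- h) x) => ?; case: (leP 0 x) => ?; case: (leP T x) => ?;
  case: (leP (T + h) x) => ?; lra.
Qed.

(** The interpolant at [x] is a convex combination of the values at nodes closer than [h]. With
    [b = phi x] this is the interpolation error, with [b = 0] a uniform bound. *)
Lemma pl_approx y x (b c : R) : 0 <= c -> y 0%N = 0 -> y N.+1 = 0 ->
  0 <= x <= T ->
  (forall i, (i <= N.+1)%N -> `|node i - x| < h -> `|y i - b| <= c) ->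
  `|pl y x - b| <= c.
Proof.
move=> c0 y0 yN xT hy; have h0 := mesh_gt0.
have -> : pl y x - b = h^-1 * \sum_(i < N.+2) (y i - b) * tentf (node i) h x.
  under eq_bigr do rewrite mulrBl.
  rewrite sumrB -mulr_sumr sum_tentf// mulrBr [h^-1 * (b * h)]mulrCA.
  rewrite mulVf ?gt_eqF// mulr1; congr (_ - _); rewrite /pl; congr (_ * _).
  rewrite big_ord_recl/= y0 mul0r add0r big_ord_recr/= yN mul0r addr0.
  by apply: eq_bigr => i _; rewrite /bump.
rewrite normrM gtr0_norm ?invr_gt0// ler_pdivrMl//.
apply: (le_trans (ler_norm_sum _ _ _)).
rewrite -[X in _ <= X * _](sum_tentf xT) mulr_suml; apply: ler_sum => i _.
rewrite normrM (ger0_norm (tentf_ge0 _ _ h0)) mulrC.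
have [ix|ix] := ltP `|node i - x| h.
  by apply: ler_wpM2l; [exact: tentf_ge0|apply: hy => //; rewrite -ltnS].
by rewrite tentf_eq0 ?mul0r// distrC.
Qed.

End Grid.

(** * Passing to the limit in the mesh size *)

Section InterpolationLimit.
Context {R : realType} (T : R).
Hypothesis T_gt0 : 0 < T.
Implicit Types (phi : R -> R).

Lemma mesh_cvg0 : mesh T N @[N --> \oo] --> (0 : R).
Proof. by rewrite -(mulr0 T); apply: cvgMl_tmp; exact: cvg_harmonic. Qed.

Lemma pl_cvg m phi : linear_on_C0 T m -> (mnorm T m < +oo)%E -> C0 T phi ->
  uniformly_continuous phi ->
  m (pl T N (fun i => phi (node T N i))) @[N --> \oo] --> m phi.
Proof.
move=> lm fm Cphi uphi; have [K K0 hK] := le_mnorm_fin lm fm.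
apply/cvgrPdist_le => e e0.
have K1 : 0 < K + 1 by rewrite ltr_wpDl.
have ek : 0 < e / (K + 1) by rewrite divr_gt0.
have [d d0 hd] := uphi _ ek.
near=> N.
have hN : mesh T N < d by near: N; exact: (cvgr_lt _ mesh_cvg0).
set p := pl _ _ _.
have Cp : C0 T p by exact: C0_pl.
rewrite distrC; have -> : m p - m phi = m (-1 *: phi + p) by rewrite lm//
  mulN1r addrC.
apply: (@le_trans _ _ (K * (e / (K + 1)))); last first.
  by rewrite mulrCA ger_pMr// ler_pdivrMr// mul1r lerDl.
apply: hK => //; first exact: C0_lin.
move=> x; rewrite -[X in `|X|]/(-1 * phi x + p x) mulN1r addrC.
have [xT|xT] := boolP (0 <= x <= T); last first.
  have xD : x \notin `]0, T[.
    by apply: contra xT; rewrite in_itv/= => /andP[/ltW -> /ltW ->].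
  by rewrite Cp.2// Cphi.2// subrr normr0 ltW.
apply: pl_approx => //; rewrite ?node0 ?nodeN ?(ltW ek)//.
- by rewrite Cphi.2// in_itv/= ltxx.
- by rewrite Cphi.2// in_itv/= ltxx andbF.
- by move=> i _ ix; apply: hd; exact: lt_trans hN.
Unshelve. all: by end_near. Qed.

(* The mean over a cell, minus the mean over (0, T), is the pairing of Du with
   the interpolation of nodal values of modulus at most 1. *)
Lemma cell_mean_bounded u m : lebesgue_measure.-integrable (`]0,
  T[%classic : set R) (EFin \o u) ->
  is_distr_deriv T u m -> exists2 K : R, 0 <= K &
    forall N k, (k < N.+1)%N -> `|(mesh T N)^-1 * cell_int T N u k| <= K.
Proof.
move=> iu um; have [[lm fm] _] := um.
have [K K0 hK] := le_mnorm_fin lm fm.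
(* The integral of [u] over (0, T): node 0 is 0 on every grid, so the coarsest grid stands for
   all. *)
pose A0 := tail_int T 0 u 0.
exists (K + `|T^-1 * A0|); first by rewrite addr_ge0.
move=> N k kN; have h0 := mesh_gt0 T_gt0 N.
(* A linear rise from 0 to 1 with a drop of 1 after node [k]: the decrement is 1 - 1/(N + 1) on cell
   [k] and - 1/(N + 1) on the others. *)
pose y i : R := i%:R / N.+1%:R - (k < i)%N%:R.
have y0 : y 0%N = 0 by rewrite /y mul0r subrr.
have yN : y N.+1 = 0 by rewrite /y divff// kN subrr.
have y1 i : (i <= N.+1)%N -> `|y i| <= 1.
  move=> iN; have a0 : 0 <= i%:R / N.+1%:R :> R by rewrite divr_ge0.
  have a1 : i%:R / N.+1%:R <= 1 :> R by rewrite ler_pdivrMr// mul1r ler_nat.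
  rewrite ler_norml /y; set a := _ / _ in a0 a1 *.
  by case: (k < i)%N; rewrite ?mulr1n ?mulr0n; apply/andP; split; lra.
have pl1 x : `|pl T N y x| <= 1.
  have [xT|xT] := boolP (0 <= x <= T); last first.
    rewrite (C0_pl T_gt0 N y).2 ?normr0//.
    by apply: contra xT; rewrite in_itv/= => /andP[/ltW -> /ltW ->].
  by rewrite -[pl T N y x]subr0; apply: pl_approx => // i iN _;
    rewrite subr0 y1.
have := hK _ _ (C0_pl T_gt0 N y) ltr01 pl1; rewrite mulr1.
rewrite (is_distr_deriv_pl T_gt0 iu um y0 yN).
have A0E : A0 = \sum_(i < N.+1) cell_int T N u i.
  have tele j : \sum_(i < j) cell_int T N u i = tail_int T N u 0 - tail_int T N
    u j.
    elim: j => [|j IH]; first by rewrite big_ord0 subrr.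
    by rewrite big_ord_recr/= IH /cell_int; ring.
  rewrite tele.
  have -> : tail_int T N u N.+1 = 0.
    rewrite /tail_int (_ : Rintegral _ _ _ = Rintegral lebesgue_measure
      (`]0, T[%classic : set R) (fun=> 0)); last first.
      apply: eq_Rintegral => x; rewrite inE/= => xD; rewrite stepfE// nodeN.
      move: xD; rewrite in_itv/= => /andP[_ /ltW]; rewrite leNgt => /negbTE ->.
      by rewrite mulr0.
    by rewrite Rintegral_cst ?mul0r//; exact: measurable_itv.
  by rewrite subr0 /A0 /tail_int !node0.
have yS i : y i - y i.+1 = (i == k)%:R - N.+1%:R^-1.
  rewrite /y -[i.+1%:R]natr1 mulrDl mul1r ltnS eq_sym.
  by case: (ltngtP k i) => _ /=; ring.
under eq_bigr do rewrite yS mulrBl.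
rewrite sumrB -mulr_sumr -A0E (bigD1 (Ordinal kN))//= eqxx mul1r big1 ?addr0;
  last first.
  by move=> i /negbTE ik; rewrite -val_eqE/= in ik; rewrite ik mul0r.
rewrite mulrBr [X in _ - X](_ : _ = T^-1 * A0) => [h1|]; last first.
  by rewrite mulrA /mesh; congr (_ * _); field; rewrite !gt_eqF.
rewrite -[X in `|X|](subrK (T^-1 * A0)) (le_trans (ler_normD _ _))//.
by rewrite lerD2r.
Qed.

End InterpolationLimit.

(** * Convergence of the cell means *)

Section CellMeans.
Context {R : realType} (T : R).
Hypothesis T_gt0 : 0 < T.
Local Notation mu := (@lebesgue_measure R).
Local Notation D := (`]0, T[%classic : set R).
Implicit Types (u : R -> R) (x : R) (N : nat).

Let mD : @measurable _ (measurableTypeR R) D := measurable_itv _.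

Definition cell_mean N u x :=
  \sum_(i < N.+1) ((mesh T N)^-1 * cell_int T N u i) * cellf T N i x.

Lemma integrable_mul_cellf u N i : mu.-integrable D (EFin \o u) ->
  mu.-integrable D (EFin \o (fun x => u x * cellf T N i x)).
Proof.
move=> iu; apply: (integrable_mul_bounded (M := 2) iu).
  by apply: measurable_funB; exact: measurable_stepf.
move=> x _; have := normr_stepf_le1 T (node T N i) x.
have := normr_stepf_le1 T (node T N i.+1) x.
rewrite !ler_norml /cellf => /andP[? ?] /andP[? ?].
by apply/andP; split; lra.
Qed.

Lemma cell_intE u N i : mu.-integrable D (EFin \o u) ->
  cell_int T N u i = \int[mu]_(x in D) (u x * cellf T N i x).
Proof.
move=> iu; rewrite /cell_int /tail_int -RintegralB//.
- by apply: eq_Rintegral => x _; rewrite /cellf mulrBr.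
- exact: integrable_mul_stepf.
- exact: integrable_mul_stepf.
Qed.

(** Left end of the grid cell containing [x], with the grid continued over the whole line so that
    every real has its cell. The ceiling minus 1 matches cells open on the left. *)
Let zcell N x : R := (Num.ceil (x / mesh T N) - 1)%:~R * mesh T N.
Let Ecell x N : set R := `]zcell N x, zcell N x + mesh T N]%classic.

Let zcellP N x : zcell N x < x <= zcell N x + mesh T N.
Proof.
have h0 := mesh_gt0 T_gt0 N; have /andP[h1 h2] := ceil_itv (x / mesh T N).
move: h1; rewrite ltr_pdivlMr// => h1; rewrite /zcell h1/=.
move: h2; rewrite ler_pdivrMr// => h2.
by apply: (le_trans h2); rewrite intrB mulrBl mul1r subrK.
Qed.

Let nicely x : nicely_shrinking x (Ecell x).
Proof.
split; first by move=> n; exact: measurable_itv.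
(* The ball of radius the mesh around [x] contains the cell and has twice its measure. *)
exists (2, fun n => PosNum (mesh_gt0 T_gt0 n)); split => //=.
- exact: mesh_cvg0.
- move=> n t; rewrite /Ecell /= in_itv/= => /andP[t1 t2].
  have /andP[x1 x2] := zcellP n x.
  by rewrite /ball/= ltr_norml; apply/andP; split; lra.
- move=> n; rewrite lebesgue_measure_ball; last exact/ltW/mesh_gt0.
  have h0 := mesh_gt0 T_gt0 n.
  rewrite lebesgue_measure_itv/= lte_fin ltrDl h0 -EFinD addrAC subrr add0r.
  by rewrite -EFinM lee_fin mulr_natl.
Qed.

Let zcell_node N x k : node T N k < x <= node T N k.+1 ->
  zcell N x = node T N k.
Proof.
have h0 := mesh_gt0 T_gt0 N.
move=> /andP[xk1 xk2]; rewrite /zcell (@ceil_def _ _ k.+1).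
  by rewrite -addn1 PoszD addrK.
rewrite -addn1 PoszD addrK ltr_pdivlMr// ler_pdivrMr//.
by rewrite -PoszD addn1 xk1 xk2.
Qed.

(* Lebesgue differentiation along the grid cell containing x. *)
Lemma cell_mean_cvg u : mu.-integrable D (EFin \o u) ->
  {ae mu, forall x, D x -> cell_mean N u x @[N --> \oo] --> u x}.
Proof.
move=> iu; pose f := u \_ D.
have lf : locally_integrable setT f by exact: integrable_locally_restrict.
apply: (@filterS _ _ (ae_filter_ringOfSetsType mu) _ _ _
  (lebesgue_differentiation lf)) => x fx xD.
have := nice_lebesgue_differentiation nicely lf fx.
have -> : f x = u x by rewrite /f patchT// mem_set.
rewrite (_ : (fun n => _) = fun n => (cell_mean n u x)%:E);
  first exact: fine_cvg.
apply/funext => N; have h0 := mesh_gt0 T_gt0 N.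
have [k kN kx] := cell_of N xD.
rewrite /cell_mean (sum_cellf T_gt0 (fun i => (mesh T N)^-1 * cell_int T N u i)
  xD kN kx).
have EE : Ecell x N = `]node T N k, node T N k.+1]%classic.
  by rewrite /Ecell (zcell_node kx) nodeS.
have -> : mu (Ecell x N) = (mesh T N)%:E.
  rewrite /Ecell lebesgue_measure_itv/= lte_fin ltrDl h0 -EFinD.
  by rewrite addrAC subrr add0r.
rewrite inver gt_eqF// EFinM; congr (_ * _)%E.
rewrite cell_intE// /Rintegral fineK; last first.
  by apply: integrable_fin_num => //; exact: integrable_mul_cellf.
rewrite [LHS]integral_mkcond [RHS]integral_mkcond. apply: eq_integral => t _.
rewrite /patch EE /f /patch.
case: (boolP (t \in D)) => tD; last by case: ifP.
rewrite (cellfE T_gt0); last by move: tD; rewrite inE.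
rewrite mem_setE in_itv/=.
by case: ifPn => _; rewrite ?mulr1 ?mulr0.
Qed.

End CellMeans.

(** * Functionals annihilating the affine functions *)

Section DualBound.
Context {R : realType} (T : R).
Hypothesis T_gt0 : 0 < T.
Local Notation mu := (@lebesgue_measure R).
Local Notation D := (`]0, T[%classic : set R).
Implicit Types (x y : R) (N : nat).

Let mD : @measurable _ (measurableTypeR R) D := measurable_itv _.

Lemma stepf_Lfun x : stepf T x \in Lfun (lebesgue0T T) 2%:E.
Proof.
apply: (Lfun_of_bounded (M := 1)); first by rewrite ler1n.
  exact: measurable_stepf.
by move=> t _; exact: normr_stepf_le1.
Qed.

Lemma rampf_Lfun x : rampf x \in Lfun (lebesgue0T T) 2%:E.
Proof.
apply: (Lfun_of_bounded (M := T + `|x|)); first by rewrite ler1n.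
  by apply: continuous_measurable_fun; exact: continuous_rampf.
by move=> t tD; exact: normr_rampf_le.
Qed.

Lemma affine_Lfun (a b : R) : (fun t : R => a * t + b) \in Lfun (lebesgue0T T)
  2%:E.
Proof.
apply: (Lfun_of_bounded (M := `|a| * T + `|b|)); first by rewrite ler1n.
  exact: measurable_affine.
by move=> t tD; exact: normr_affine_le.
Qed.

Definition stepL2 x : L2 T := Lfun_Sub (lee1n 2) (stepf_Lfun x).
Definition rampL2 x : L2 T := Lfun_Sub (lee1n 2) (rampf_Lfun x).
Definition affineL2 (a b : R) : L2 T := Lfun_Sub (lee1n 2) (affine_Lfun a b).

Lemma L2_sumE (I : finType) (F : I -> L2 T) x : (\sum_i F i) x = \sum_i F i x.
Proof. by elim/big_ind2: _ => // ? ? ? ? <- <-. Qed.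

Lemma L2_measurable (u : L2 T) : measurable_fun setT (u : R -> R).
Proof. by have := LfunP u; rewrite inE => /andP[+ _]; rewrite inE. Qed.

Lemma L2_integrable (u : L2 T) : mu.-integrable D (EFin \o u).
Proof. exact/Lfun1_integrable0T/L2_Lfun1. Qed.

Lemma stepL2_diff x y (e : R) : 0 < e -> `|x - y| < e ^+ 2 ->
  (L2norm T (stepL2 x - stepL2 y)%R < e%:E)%E.
Proof.
move=> e0 xye; apply: (@L2norm_lt_support _ _ _ 1 (Num.min x y) (Num.max x y))
  => //.
- exact: L2_measurable.
- by rewrite ge_min !le_max !lexx.
- move=> t tD; rewrite -[X in `|X|]/(stepf T x t - stepf T y t) !stepfE//.
  by case: (x < t)%R; case: (y < t)%R; rewrite /= ?subrr ?subr0 ?sub0r ?normrN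
    ?normr1 ?normr0.
- move=> t tD; rewrite in_itv/= negb_and -!ltNge gt_max lt_min.
  rewrite -[LHS]/(stepf T x t - stepf T y t) !stepfE//.
  move=> /orP[/andP[h1 h2]|/andP[h1 h2]].
    by rewrite !ltNge (ltW h1) (ltW h2) subrr.
  by rewrite h1 h2 subrr.
- by rewrite expr1n mul1r; move: xye; case: (leP x y) => xy;
    rewrite ltr_norml => /andP[]; lra.
Qed.

(** The radius d / (T + 1) replaces d over the square root of T in the modulus of continuity of
    ramps. *)
Lemma sqr_mul_lt (d z : R) : 0 < d -> `|z| < d / (T + 1) ->
  `|z| ^+ 2 * T < d ^+ 2.
Proof.
move=> d0 zd; have T1 : 0 < T + 1 by rewrite addr_gt0.
apply: (@le_lt_trans _ _ ((d / (T + 1)) ^+ 2 * T)).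
  by rewrite ler_pM2r// lerXn2r// ?nnegrE ?divr_ge0 ?ltW.
rewrite exprMn -mulrA gtr_pMr ?exprn_gt0// exprVn mulrC ltr_pdivrMr
  ?exprn_gt0// mul1r.
by rewrite expr2; nra.
Qed.

Lemma rampL2_diff x y (e : R) : 0 < e -> `|x - y| ^+ 2 * T < e ^+ 2 ->
  (L2norm T (rampL2 x - rampL2 y)%R < e%:E)%E.
Proof.
move=> e0 xye; apply: (@L2norm_lt_support _ _ _ `|x - y| 0 T) => //.
- exact: L2_measurable.
- exact: ltW.
- move=> t _; rewrite -[X in `|X| <= _]/(rampf x t - rampf y t) !rampfE.
  have h1 := ler_norm (x - y); have h2 := ler_norm (y - x);
    rewrite distrC in h2.
  by rewrite ler_norml; case: (leP x t); case: (leP y t) => ? ?; apply/andP;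
    split; lra.
- by move=> t tD /negP; case; exact: subset_itv_oo_cc.
- by rewrite subr0.
Qed.

Lemma measurable_cellf N i : measurable_fun setT (cellf T N i).
Proof. exact: (measurable_funB (measurable_stepf T _) (measurable_stepf T _)).
  Qed.

Section Functional.
Variable L : L2 T -> R.
Hypothesis L_lin : forall (a : R) (u v : L2 T), L (a *: u + v) = a * L u + L v.
Hypothesis L_cont : forall e : R, 0 < e -> exists2 d : R, 0 < d &
  forall u : L2 T, (L2norm T u < d%:E)%E -> `|L u| < e.
Hypothesis L_affine : forall a b, L (affineL2 a b) = 0.

Let LB u v : L (u - v) = L u - L v.
Proof. by rewrite -[u - v]addrC -scaleN1r L_lin mulN1r addrC. Qed.

Let L0 : L 0 = 0.
Proof. by rewrite -(subrr 0) LB subrr. Qed.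

Let LZ a u : L (a *: u) = a * L u.
Proof. by rewrite -[a *: u]addr0 L_lin L0 addr0. Qed.

Let L_sum (I : finType) (c : I -> R) (F : I -> L2 T) :
  L (\sum_i c i *: F i) = \sum_i c i * L (F i).
Proof.
elim: (index_enum I) => [|i s IH]; first by rewrite !big_nil L0.
by rewrite !big_cons L_lin IH.
Qed.

Let L_eq (u v : L2 T) : {in `]0, T[, u =1 v} -> L u = L v.
Proof.
move=> uv; apply/eqP; rewrite -subr_eq0 -LB -normr_le0;
  apply/ler_addgt0Pl => e e0.
rewrite addr0; have [d d0 hd] := L_cont e0; apply/ltW/hd.
apply: (@L2norm_lt_support _ _ _ 0 0 T) => //.
- exact: L2_measurable.
- exact: ltW.
- by move=> t tD; rewrite -[X in `|X|]/(u t - v t) uv// subrr normr0.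
- by move=> t tD _; rewrite -[LHS]/(u t - v t) uv// subrr.
- by rewrite expr0n mul0r exprn_gt0.
Qed.

(** [stepval] and [rampval] are V and k of the overview, for [L] = q composed with H. *)
Definition stepval x := L (stepL2 x).
Definition rampval x := L (rampL2 x).

Let stepval_ucont : uniformly_continuous stepval.
Proof.
move=> e e0; have [d d0 hd] := L_cont e0.
exists (d ^+ 2); first by rewrite exprn_gt0.
by move=> x y xy; rewrite /stepval -LB; apply/ltW/hd; exact: stepL2_diff.
Qed.

Let rampval_ucont : uniformly_continuous rampval.
Proof.
move=> e e0; have [d d0 hd] := L_cont e0.
exists (d / (T + 1)); first by rewrite divr_gt0// addr_gt0.
move=> x y xy; rewrite /rampval -LB; apply/ltW/hd; apply: rampL2_diff => //.
exact: sqr_mul_lt.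
Qed.

Let uc_continuous (f : R -> R) : uniformly_continuous f -> continuous f.
Proof.
move=> uf x; apply/cvgrPdist_le => e e0; have [d d0 hd] := uf _ e0.
by apply/nbhs_ballP; exists d => // y xy; apply: hd.
Qed.

(** On (0, T) a step placed at x <= 0 is 1 and one placed at x >= T is 0: both are affine. *)
Let C0_stepval : C0 T stepval.
Proof.
split; first exact: uc_continuous.
move=> x; rewrite in_itv/= negb_and -!leNgt => /orP[x0|Tx].
  rewrite -(L_affine 0 1); apply: L_eq => t tD.
  rewrite -[LHS]/(stepf T x t) -[RHS]/(0 * t + 1) mul0r add0r stepfE//.
  by move: tD; rewrite in_itv/= => /andP[t0 _]; rewrite (le_lt_trans x0 t0).
rewrite -(L_affine 0 0); apply: L_eq => t tD.
rewrite -[LHS]/(stepf T x t) -[RHS]/(0 * t + 0) mul0r add0r stepfE//.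
by move: tD; rewrite in_itv/= => /andP[_ tT]; rewrite ltNge (ltW (lt_le_trans
  tT Tx)).
Qed.

Let C0_rampval : C0 T rampval.
Proof.
split; first exact: uc_continuous.
move=> x; rewrite in_itv/= negb_and -!leNgt => /orP[x0|Tx].
  rewrite -(L_affine 1 (- x)); apply: L_eq => t tD.
  rewrite -[LHS]/(rampf x t) -[RHS]/(1 * t + - x) mul1r rampfE.
  by move: tD; rewrite in_itv/= => /andP[t0 _]; rewrite (le_trans x0 (ltW t0)).
rewrite -(L_affine 0 0); apply: L_eq => t tD.
rewrite -[LHS]/(rampf x t) -[RHS]/(0 * t + 0) mul0r add0r rampfE.
by move: tD; rewrite in_itv/= => /andP[_ tT]; rewrite leNgt (lt_le_trans tT Tx).
Qed.

Let node_ends (f : R -> R) N : C0 T f -> f (node T N 0) = 0 /\ f (node T N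
  N.+1) = 0.
Proof.
by move=> [_ f0]; rewrite node0 nodeN; split; apply: f0;
  rewrite in_itv/= ltxx// andbF.
Qed.

(** A uniform discrete form of k' = - V. The difference quotient of two ramps at consecutive nodes
    takes values in [0, 1] and agrees with the step at [x] off the cell; the two are therefore close
    in L^2 once the mesh is small. *)
Let slope_approx (e : R) : 0 < e -> \forall N \near \oo, forall k x,
  x \in `]0, T[ -> node T N k < x <= node T N k.+1 ->
  `|(mesh T N)^-1 * (rampval (node T N k) - rampval (node T N k.+1)) - stepval
    x| <= e.
Proof.
move=> e0; have [d d0 hd] := L_cont e0.
near=> N => k x xD /andP[kx xk]; have h0 := mesh_gt0 T_gt0 N.
have hN : mesh T N < d ^+ 2.
  by near: N; apply: (cvgr_lt _ (mesh_cvg0 T)); rewrite exprn_gt0.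
rewrite /rampval /stepval -LB -LZ -LB; apply/ltW/hd.
have kS := nodeS T N k.
apply: (@L2norm_lt_support _ _ _ 1 (node T N k) (node T N k.+1)) => //.
- exact: L2_measurable.
- by rewrite kS lerDl ltW.
- move=> t tD; rewrite -[X in `|X|]/((mesh T N)^-1 *
    (rampf (node T N k) t - rampf (node T N k.+1) t) - stepf T x t).
  set q := (mesh T N)^-1 * _.
  have [q0 q1] : 0 <= q /\ q <= 1.
    rewrite /q !rampfE kS; split.
      by rewrite mulr_ge0 ?invr_ge0 ?(ltW h0)//;
        case: (leP (node T N k) t) => ?; case: (leP (node T N k + mesh T N) t)
          => ?; lra.
    by rewrite ler_pdivrMl// mulr1; case: (leP (node T N k) t) => ?;
      case: (leP (node T N k + mesh T N) t) => ?; lra.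
  by rewrite stepfE// ler_norml; case: (x < t)%R; rewrite ?mulr1n ?mulr0n;
    apply/andP; split; lra.
- move=> t tD; rewrite in_itv/= negb_and -!ltNge => tk.
  rewrite -[LHS]/((mesh T N)^-1 *
    (rampf (node T N k) t - rampf (node T N k.+1) t) - stepf T x t).
  rewrite stepfE// !rampfE; case/orP: tk => tk.
    rewrite ltNge (ltW (lt_trans tk kx)) leNgt tk leNgt (lt_trans tk)//=.
      by rewrite subrr mulr0 subrr.
    by rewrite kS ltrDl.
  rewrite (le_lt_trans xk tk) (ltW tk) ltW ?(lt_trans (lt_le_trans kx xk) tk)//.
  rewrite kS (_ : _ - _ - _ = mesh T N); last by ring.
  by rewrite mulVf ?gt_eqF// subrr.
- by rewrite expr1n mul1r kS addrAC subrr add0r.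
Unshelve. all: by end_near. Qed.

Lemma L2_integrable_sqr (u : L2 T) : mu.-integrable D (EFin \o (fun x =>
  u x ^+ 2)).
Proof.
have mu_ := L2_measurable u.
apply/integrableP; split; first
  exact/measurable_EFinP/measurable_funX/measurable_funTS.
under eq_integral do rewrite /= ger0_norm ?sqr_ge0//.
by rewrite -L2norm_sqr//; apply: poweR_lty; exact: Lfunction_finite.
Qed.

(** The derivative is needed for domination: it bounds the cell means by a constant [K], whence (c -
    u)^2 <= 2 K^2 + 2 u^2. *)
Lemma cell_mean_cvg_L2 (u : L2 T) m : is_distr_deriv T u m ->
  (\int[mu]_(x in D) ((cell_mean T N u x - u x) ^+ 2)%:E @[N --> \oo] --> 0)%E.
Proof.
move=> um; have iu := L2_integrable u.
have [K K0 hK] := cell_mean_bounded T_gt0 iu um.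
have mcm N : measurable_fun setT (fun x => (cell_mean T N u x - u x) ^+ 2).
  apply: measurable_funX; apply: measurable_funB; last exact: L2_measurable.
  apply: measurable_sum => i; apply: measurable_funM => //.
  exact: measurable_cellf.
have [] := @dominated_convergence _ _ _ mu D mD
  (fun N x => ((cell_mean T N u x - u x) ^+ 2)%:E) (fun=> 0%E)
  (fun x => (2 * u x ^+ 2 + 2 * K ^+ 2)%:E).
- by move=> N; apply/measurable_EFinP; apply: measurable_funTS; exact: mcm.
- exact: measurable_cst.
- apply: (@filterS _ _ (ae_filter_ringOfSetsType mu) _ _ _ (cell_mean_cvg T_gt0
    iu)).
  move=> x hx xD; apply: cvg_EFin; first by apply: nearW.
  have h1 : cell_mean T N u x - u x @[N --> \oo] --> u x - u x.
    by apply: cvgB; [exact: hx|exact: cvg_cst].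
  rewrite subrr in h1.
  rewrite (_ : _ \o _ = fun N => (cell_mean T N u x - u x) * (cell_mean T N u
    x - u x)).
    by rewrite -[X in _ --> X](mulr0 0); exact: cvgM.
  by apply/funext => N.
- apply: (integrable_lin 2 (L2_integrable_sqr u)).
  by apply: (integrable_of_bounded (M := `|2 * K ^+ 2|)).
- apply: aeW => x N xD; rewrite lee_fin ger0_norm ?sqr_ge0//.
  have [k kN kx] := cell_of N xD.
  rewrite /cell_mean
    (sum_cellf T_gt0 (fun i => (mesh T N)^-1 * cell_int T N u i) xD kN kx).
  have := hK N k kN; rewrite ler_norml; set c := _ * _ => /andP[c1 c2].
  have cK : c ^+ 2 <= K ^+ 2 by rewrite -[c ^+ 2]real_normK ?num_real// lerXn2r
    ?nnegrE// ler_norml c1.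
  by have := sqr_ge0 (c + u x); rewrite sqrrB sqrrD; lra.
by move=> _ _; rewrite integral0.
Qed.

Lemma Lval_eq_pairing (u : L2 T) Du : is_distr_deriv T u Du -> L u = Du stepval.
Proof.
move=> du; have iu := L2_integrable u.
have [[lm fm] _] := du.
pose P N : L2 T := \sum_(i < N.+1) ((mesh T N)^-1 * cell_int T N u i) *:
  (stepL2 (node T N i) - stepL2 (node T N i.+1)).
have PE N x : P N x = cell_mean T N u x by rewrite /P L2_sumE.
have LP N : L (P N) = Du (pl T N (fun i => stepval (node T N i))).
  have [v0 vN] := node_ends N C0_stepval.
  rewrite (is_distr_deriv_pl T_gt0 iu du)// L_sum mulr_sumr.
  by apply: eq_bigr => i _; rewrite LB /stepval; ring.
have l1 : L (P N) @[N --> \oo] --> Du stepval.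
  rewrite (_ : (fun N => L (P N)) = fun N => Du (pl T N (fun i =>
    stepval (node T N i)))).
    exact: pl_cvg.
  by apply/funext => N.
have l2 : L (P N) @[N --> \oo] --> L u.
  apply/cvgrPdist_lt => e e0; have [d d0 hd] := L_cont e0.
  have d2 : (0 < (d ^+ 2)%:E)%E by rewrite lte_fin exprn_gt0.
  near=> N; rewrite distrC -LB; apply: hd; apply: L2norm_lt => //.
    exact: L2_measurable.
  under eq_integral do rewrite -[X in X ^+ 2]/(P N _ - u _) PE.
  by near: N; exact: (cell_mean_cvg_L2 du (open_ereal_lt' d2)).
exact: (cvg_unique _ l2 l1).
Unshelve. all: by end_near. Qed.

(** Pairing [Dw] with the interpolant of k gives the integral of [w] against the step function [psi]
    of slopes of k, up to sign; [psi] tends to V uniformly, so integrability of [w] suffices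
    here. *)
Lemma pairing_rampval w Dw : BV T w -> is_distr_deriv T w Dw ->
  Dw rampval = \int[mu]_(x in D) (w x * stepval x).
Proof.
move=> [/Lfun1_integrable0T iw _] dw; have [[lm fm] _] := dw.
pose slope N i := (mesh T N)^-1 * (rampval (node T N i) - rampval (node T N
  i.+1)).
pose psi N x := \sum_(i < N.+1) slope N i * cellf T N i x.
pose Phi N (s : seq 'I_N.+1) x := w x * \sum_(i <- s) slope N i * cellf T N i x.
(* Linearity of the integral requires integrability of each partial sum, hence a joint induction
   over lists of cells. *)
have key N s : mu.-integrable D (EFin \o Phi N s) /\
    \sum_(i <- s) slope N i * cell_int T N w i = \int[mu]_(x in D) Phi N s x.
  elim: s => [|i s [i1 h1]].
    have -> : Phi N [::] = fun=> 0.
      by apply/funext => x; rewrite /Phi big_nil mulr0.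
    rewrite big_nil Rintegral_cst ?mul0r//; split => //.
    by apply: (integrable_of_bounded (M := 0)) => // x _; rewrite normr0.
  have -> : Phi N (i :: s) = fun x => slope N i * (w x * cellf T N i x) + Phi N
    s x.
    by apply/funext => x; rewrite /Phi big_cons; ring.
  have i2 := integrable_mul_cellf N i iw.
  rewrite big_cons; split; first exact: integrable_lin.
  rewrite h1 cell_intE// -RintegralZl// -RintegralD//.
  exact: (integrableZl mD (slope N i) i2).
have l1 : Dw (pl T N (fun i => rampval (node T N i))) @[N --> \oo] -->
  Dw rampval.
  exact: pl_cvg.
have DE N : Dw (pl T N (fun i => rampval (node T N i))) =
    \int[mu]_(x in D) (w x * psi N x).
  have [v0 vN] := node_ends N C0_rampval.
  rewrite (is_distr_deriv_pl T_gt0 iw dw)// mulr_sumr.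
  rewrite -(key N _).2; apply: eq_bigr => i _; by rewrite /slope mulrA.
have l2 : Dw (pl T N (fun i => rampval (node T N i))) @[N --> \oo] -->
    \int[mu]_(x in D) (w x * stepval x).
  apply/cvgrPdist_le => e e0; set W := \int[mu]_(x in D) `|w x|.
  have W0 : 0 <= W by apply: Rintegral_ge0.
  have W1 : 0 < W + 1 by rewrite ltr_wpDl.
  have e1 : 0 < e / (W + 1) by rewrite divr_gt0.
  near=> N; rewrite distrC DE.
  have [M _ hM] := C0_bounded C0_stepval.
  have mV := C0_measurable C0_stepval.
  have iV := integrable_mul_bounded iw mV (fun x _ => hM x).
  rewrite -RintegralB//; last exact: (key N _).1.
  under eq_Rintegral do rewrite -mulrBr.
  apply: (@le_trans _ _ (e / (W + 1) * W)); last first.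
    by rewrite mulrAC ler_pdivrMr// ler_wpM2l ?(ltW e0)// lerDl.
  apply: normr_Rintegral_mul_le => //.
    apply: measurable_funB => //; apply: measurable_sum => i.
    by apply: measurable_funM => //; exact: measurable_cellf.
  move=> x xD; have [k kN kx] := cell_of N xD.
  rewrite /psi (sum_cellf T_gt0 (slope N) xD kN kx) /slope.
  move: k x xD kN kx; near: N.
  by apply: filterS (slope_approx e1) => N hN k x xD _; exact: hN.
exact: (cvg_unique _ l1 l2).
Unshelve. all: by end_near. Qed.

Lemma dual_bound (alpha beta : R) (u : L2 T) : 0 < alpha -> 0 < beta ->
  (forall x, `|stepval x| <= alpha) -> (forall x, `|rampval x| <= beta) ->
  ((L u)%:E <= TGV T alpha beta u)%E.
Proof.
move=> a0 b0 hstep hramp.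
apply: le_ereal_inf_tmp => _ [w [Du [Dw [bw du dw ->]]]].
have iw : mu.-integrable D (EFin \o w) by case: bw => /Lfun1_integrable0T.
have lDu := du.1.1; have lDw := dw.1.1.
rewrite (Lval_eq_pairing du).
have -> : Du stepval = (Du stepval - dens T w stepval) + Dw rampval.
  by rewrite (pairing_rampval bw dw) /dens subrK.
rewrite EFinD; apply: leeD.
  apply: (@le_trans _ _ (`|Du stepval - dens T w stepval|%:E)).
    by rewrite lee_fin ler_norm.
  apply: (@le_mnorm _ _ (fun phi => Du phi - dens T w phi)) => //.
  move=> c phi psi Cphi Cpsi; rewrite lDu// (dens_linear iw)//; ring.
apply: (@le_trans _ _ (`|Dw rampval|%:E)); first by rewrite lee_fin ler_norm.
exact: le_mnorm.
Qed.

End Functional.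

End DualBound.

(** * The variational problem *)

Lemma kink_rampf {R : realType} (T x t : R) : t \in `]0, T[ ->
  kink T x t = rampf x t - (x < T / 2)%R%:R * (t - x).
Proof.
rewrite in_itv/= => /andP[t0 tT]; rewrite /kink rampfE; case: ltP => _.
  rewrite indicE mem_setE in_itv/= t0/= mul1r ltNge.
  by case: leP => _ /=; ring.
rewrite indicE mem_setE in_itv/= tT andbT mul0r subr0.
by case: ltgtP => [_|_|->] /=; ring.
Qed.

Lemma sum_over_support (V : nmodType) (J : finType) (A : {set J})
    (f : J -> V) : (forall j, j \notin A -> f j = 0) ->
  \sum_j f j = \sum_(i < #|A|) f (enum_val i).
Proof.
move=> f0; rewrite -(big_enum_val f) [LHS](bigID (mem A))/=.
by rewrite [X in _ + X]big1 ?addr0.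
Qed.

Section Assembly.
Context {R : realType} (T alpha beta : R) {Y : normedVectType R}.
Context (H : {linear L2 T -> Y}).
Hypotheses (T_gt0 : 0 < T) (alpha_gt0 : 0 < alpha) (beta_gt0 : 0 < beta).
Hypothesis H_cont : L2_continuous H.
Variable HL : {vspace Y}.
Hypothesis HLE : [set y | y \in HL] = H @` affine T.

(** For [x] in (0, T) the scaling makes the TGV of an atom at most 1, so that total mass bounds
    TGV. *)
Definition atom (b : bool) (x : R) : L2 T :=
  if b then beta^-1 *: rampL2 T x else alpha^-1 *: stepL2 T x.

(** Functions are not quotiented, so compatibility with equality almost everywhere comes from
    continuity: [u - v] has norm 0. *)
Lemma H_eq_ae (u v : L2 T) : u = v %[ae lebesgue0T T] -> H u = H v.
Proof.
move=> uv; apply/eqP; rewrite -subr_eq0 -normr_le0; apply/ler_addgt0Pl => e e0.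
rewrite addr0; have [d d0 hd] := H_cont v e0; apply/ltW/hd.
rewrite L2norm_ae0 ?lte_fin//; last exact: (@L2_measurable _ _ (u - v)).
case: uv => N [mN N0 sub]; exists N; split => // t h.
apply: sub => /= h2; apply: h => _ /=.
by rewrite -[LHS]/(u t - v t) h2// subrr.
Qed.

Lemma affineL2_affine (a b : R) : affine T (affineL2 T a b).
Proof. by exists a, b; exact: aeW. Qed.

Lemma HL_affineL2 a b : H (affineL2 T a b) \in HL.
Proof.
have : (H @` affine T) (H (affineL2 T a b)) by exists (affineL2 T a b) => //;
  exact: affineL2_affine.
by rewrite -HLE.
Qed.

Lemma HL_affineL2_inv y : y \in HL -> exists a b, y = H (affineL2 T a b).
Proof.
move=> yHL; have : (H @` affine T) y by rewrite -HLE.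
case=> u [a [b uab]] <-; exists a, b; apply: H_eq_ae.
by case: uab => N [mN N0 sub]; exists N.
Qed.

Lemma H_atom_out b x : x \notin `]0, T[ -> H (atom b x) \in HL.
Proof.
have eqD (u v : L2 T) : {in `]0, T[, u =1 v} -> H u = H v.
  by move=> uv; apply: H_eq_ae; apply: ae_lebesgue0T => t tD _; exact: uv.
rewrite in_itv/= negb_and -!leNgt => hx; rewrite /atom; case: b;
  rewrite linearZ; apply: memvZ.
  case/orP: hx => hx.
    rewrite (eqD _ (affineL2 T 1 (- x))); first exact: HL_affineL2.
    move=> t; rewrite in_itv/= => /andP[t0 _].
    rewrite -[LHS]/(rampf x t) -[RHS]/(1 * t + - x) mul1r rampfE.
    by rewrite (le_trans hx (ltW t0)).
  rewrite (eqD _ (affineL2 T 0 0)); first exact: HL_affineL2.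
  move=> t; rewrite in_itv/= => /andP[_ tT].
  rewrite -[LHS]/(rampf x t) -[RHS]/(0 * t + 0) mul0r add0r rampfE.
  by rewrite leNgt (lt_le_trans tT hx).
case/orP: hx => hx.
  rewrite (eqD _ (affineL2 T 0 1)); first exact: HL_affineL2.
  move=> t tD; rewrite -[LHS]/(stepf T x t) -[RHS]/(0 * t + 1) mul0r add0r
    stepfE//.
  by move: tD; rewrite in_itv/= => /andP[t0 _]; rewrite (le_lt_trans hx t0).
rewrite (eqD _ (affineL2 T 0 0)); first exact: HL_affineL2.
move=> t tD; rewrite -[LHS]/(stepf T x t) -[RHS]/(0 * t + 0) mul0r add0r
  stepfE//.
by move: tD; rewrite in_itv/= => /andP[_ tT]; rewrite ltNge (ltW (lt_le_trans
  tT hx)).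
Qed.

Lemma continuous_H_atom b : continuous (fun x => H (atom b x)).
Proof.
have cs : continuous (fun x => H (stepL2 T x)).
  move=> x; apply/(@cvgrPdist_lt _ Y) => e e0;
    have [d d0 hd] := H_cont (stepL2 T x) e0.
  apply/nbhs_ballP; exists (d ^+ 2); first by rewrite /= exprn_gt0.
  by move=> y xy; rewrite distrC; apply: hd; apply: stepL2_diff => //;
    rewrite distrC.
have cr : continuous (fun x => H (rampL2 T x)).
  move=> x; apply/(@cvgrPdist_lt _ Y) => e e0;
    have [d d0 hd] := H_cont (rampL2 T x) e0.
  apply/nbhs_ballP; exists (d / (T + 1)); first by rewrite /= divr_gt0//
    addr_gt0.
  move=> y xy; rewrite distrC; apply: hd; apply: rampL2_diff => //;
    rewrite distrC.
  exact: sqr_mul_lt.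
move=> x; rewrite /atom; case: b; rewrite /continuous_at linearZ;
  under eq_fun do rewrite linearZ; apply: (@cvgZl_tmp _ Y);
    [exact: cr|exact: cs].
Qed.

End Assembly.

Theorem theorem6 (R : realType) (T alpha beta : R)
    (T_gt0 : 0 < T) (alpha_gt0 : 0 < alpha) (beta_gt0 : 0 < beta)
    (N : nat) (Y : normedVectType R) (dimY : \dim {:Y} = N)
    (inner : {dot Y for idfun}) (innerE : forall y, inner y y = `|y| ^+ 2)
    (H : {linear L2 T -> Y}) (H_cont : L2_continuous H)
    (H_surj : range H = setT)
    (F : Y -> R) (F_convex : convex_function setT F)
    (F_C1 : continuously_differentiable F) (F_coercive : norm_coercive F)
    (HL : {vspace Y}) (HLE : [set y | y \in HL] = H @` affine T) :
  let objective (u : L2 T) := ((F (H u))%:E + TGV T alpha beta u)%E in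
  exists ubar : L2 T,
    [/\ BV T ubar,
        forall u : L2 T, BV T u -> (objective ubar <= objective u)%E &
        exists (NS NK : nat)
               (xS sS lS : 'I_NS -> R) (xK sK lK : 'I_NK -> R) (a b : R),
          [/\ [/\ injective xS, forall j, xS j \in `]0, T[,
                  forall j, sS j \in [:: -1; 1] & forall j, 0 <= lS j],
              [/\ injective xK, forall j, xK j \in `]0, T[,
                  forall j, sK j \in [:: -1; 1] & forall j, 0 <= lK j],
              (ubar : R -> R) = (fun x =>
                 alpha^-1 * (\sum_(j < NS) sS j * lS j * stepf T (xS j) x)
                 + beta^-1 * (\sum_(j < NK) sK j * lK j * kink T (xK j) x)
                 + a * x + b) %[ae lebesgue0T T],
              (NK + NS <= N - \dim HL)%N &
              TGV T alpha beta ubar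
                = (\sum_(j < NS) lS j + \sum_(j < NK) lK j)%:E]].
Proof.
move=> objective.
have [m [l [x [h [y [hHL yE [card xin inj] [Flow dHL da sl]]]]]]] :=
  sparse_minimizer T_gt0 F_convex F_C1.1 F_coercive
    (@continuous_H_atom _ _ alpha beta _ _ T_gt0 H_cont) (H_atom_out alpha beta
      H_cont HLE).
have [c0 [d0 hE]] := HL_affineL2_inv H_cont HLE hHL.
pose ubar : L2 T := \sum_j l j *: atom T alpha beta j.1 (x j) + affineL2 T c0
  d0.
have HubarE : H ubar = y.
  rewrite /ubar linearD linear_sum/= -hE yE; congr (_ + _).
  by apply: eq_bigr => j _; rewrite linearZ.
(* The support of [l] is split by kind; its enumerations provide the indices of the steps and of the
   kinks. *)
pose SS := [set j : bool * 'I_m | (~~ j.1 && (l j != 0))%R]%SET.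
pose SK := [set j : bool * 'I_m | (j.1 && (l j != 0))%R]%SET.
pose jS (i : 'I_#|SS|) : bool * 'I_m := enum_val i.
pose jK (i : 'I_#|SK|) : bool * 'I_m := enum_val i.
have jSP i : (jS i).1 = false /\ l (jS i) != 0.
  by have := enum_valP i; rewrite inE => /andP[/negbTE].
have jKP i : (jK i).1 = true /\ l (jK i) != 0.
  by have := enum_valP i; rewrite inE => /andP[].
have xS_in i : x (jS i) \in `]0, T[ by have [_] := jSP i; exact: xin.
have xK_in i : x (jK i) \in `]0, T[ by have [_] := jKP i; exact: xin.
have split_sum (V : nmodType) (f : bool * 'I_m -> V) : (forall j, l j = 0 ->
  f j = 0) ->
    \sum_j f j = \sum_i f (jS i) + \sum_i f (jK i).
  move=> f0; rewrite (bigID (fun j => j.1))/= addrC; congr (_ + _).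
    rewrite big_mkcond/= (sum_over_support (A := SS)).
      by apply: eq_bigr => i _; rewrite -/(jS i) (jSP i).1.
    by move=> j; rewrite inE negb_and !negbK; case: (j.1) => //= /eqP;
      exact: f0.
  rewrite big_mkcond/= (sum_over_support (A := SK)).
    by apply: eq_bigr => i _; rewrite -/(jK i) (jKP i).1.
  by move=> j; rewrite inE negb_and negbK; case: (j.1) => //= /eqP; exact: f0.
have ubarE t : ubar t = alpha^-1 * (\sum_i l (jS i) * stepf T (x (jS i)) t) +
    (beta^-1 * (\sum_i l (jK i) * rampf (x (jK i)) t) + (c0 * t + d0)).
  rewrite -[ubar t]/((\sum_j l j *: atom T alpha beta j.1 (x j)) t + (c0 * t +
    d0)).
  rewrite L2_sumE [RHS]addrA; congr (_ + _).
  rewrite (split_sum R (fun j => (l j *: atom T alpha beta j.1 (x j)) t));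
    last first.
    by move=> j lj; rewrite lj scale0r.
  congr (_ + _); rewrite mulr_sumr; apply: eq_bigr => i _.
    by rewrite (jSP i).1 -[LHS]/(l (jS i) * (alpha^-1 * stepf T (x (jS i)) t))
      mulrCA.
  by rewrite (jKP i).1 -[LHS]/(l (jK i) * (beta^-1 * rampf (x (jK i)) t))
    mulrCA.
have [[Dubar dubar] TGV_ub] := TGV_le T_gt0 alpha_gt0 beta_gt0 xS_in xK_in
  (fun t _ => ubarE t).
have sumE : \sum_i `|l (jS i)| + \sum_i `|l (jK i)| = \sum_j `|l j|.
  by rewrite (split_sum R (fun j => `|l j|))// => j ->; rewrite normr0.
rewrite sumE in TGV_ub.
pose L (u : L2 T) := - 'd F y (H u).
have L_lin (a : R) u v : L (a *: u + v) = a * L u + L v.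
  by rewrite /L !linearP/= -[a *: _]/(a * _); ring.
have L_cont (e : R) : 0 < e -> exists2 d : R, 0 < d &
    forall u : L2 T, (L2norm T u < d%:E)%E -> `|L u| < e.
  move=> e0; have dc : {for (0 : Y), continuous ('d F y : Y -> R)}.
    by apply: diff_continuous; exact: F_C1.1.
  have : \forall z \near (0 : Y), `|'d F y 0 - 'd F y z| < e.
    exact: (@cvgr_dist_lt _ R _ _ _ _ _ dc).
  rewrite linear0 => /nbhs_ballP[r /= r0 hr].
  have [d d0' hd] := H_cont 0 _ r0; exists d => // u ud.
  rewrite /L; have /hr : ball (0 : Y) r (H u).
    rewrite -ball_normE/= sub0r normrN.
    by have := hd u; rewrite subr0 linear0 subr0; apply.
  by rewrite sub0r.
have L_aff a b : L (affineL2 T a b) = 0.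
  by rewrite /L dHL ?oppr0//; exact: (HL_affineL2 HLE).
have Lstep t : `|stepval L t| <= alpha.
  have := da false t; rewrite linearZ linearZ/= -[_ *: _]/(alpha^-1 * _).
  by rewrite normrM gtr0_norm ?invr_gt0// ler_pdivrMl// mulr1 /stepval /L
    normrN.
have Lramp t : `|rampval L t| <= beta.
  have := da true t; rewrite linearZ linearZ/= -[_ *: _]/(beta^-1 * _).
  by rewrite normrM gtr0_norm ?invr_gt0// ler_pdivrMl// mulr1 /rampval /L
    normrN.
have dual u := dual_bound T_gt0 L_lin L_cont L_aff u alpha_gt0 beta_gt0 Lstep
  Lramp.
have TGV_eq : TGV T alpha beta ubar = (\sum_j `|l j|)%:E.
  apply/le_anti; rewrite TGV_ub/= (le_trans _ (dual ubar))// lee_fin.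
  by rewrite /L HubarE.
exists ubar; split.
- by split; [exact: L2_Lfun1|exists Dubar].
- move=> u _; rewrite /objective TGV_eq HubarE.
  apply: (@le_trans _ _ ((F (H u))%:E + (L u)%:E)%E); last exact: leeD2l.
  rewrite -!EFinD lee_fin; have := Flow (H u); rewrite linearB/= /L.
  by have := sl; lra.
(* Unlike [Num.sg], this sign is never 0. *)
pose sg (r : R) : R := if 0 <= r then 1 else -1.
have sgE r : sg r * `|r| = r.
  rewrite /sg; case: leP => r0; first by rewrite mul1r ger0_norm.
  by rewrite mulN1r ltr0_norm// opprK.
have sg_in r : sg r \in [:: -1; 1].
  by rewrite /sg; case: ifP => _; rewrite !inE eqxx ?orbT.
(* A ramp at x < T / 2 exceeds the kink at x by t - x; these corrections are collected in the affine
   part. *)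
exists #|SS|, #|SK|, (x \o jS), (sg \o l \o jS), (fun i => `|l (jS i)|),
  (x \o jK), (sg \o l \o jK), (fun i => `|l (jK i)|),
  (c0 + beta^-1 * \sum_i l (jK i) * (x (jK i) < T / 2)%R%:R),
  (d0 - beta^-1 * \sum_i l (jK i) * (x (jK i) < T / 2)%R%:R * x (jK i)).
split.
- split => [i j xij|//|i|//]; last exact: sg_in.
  apply: enum_val_inj.
  have [b1 l1] := jSP i; have [b2 l2] := jSP j.
  by apply: inj => //; rewrite -/(jS i) -/(jS j) b1 b2.
- split => [i j xij|//|i|//]; last exact: sg_in.
  apply: enum_val_inj.
  have [b1 l1] := jKP i; have [b2 l2] := jKP j.
  by apply: inj => //; rewrite -/(jK i) -/(jK j) b1 b2.
- apply: ae_lebesgue0T => t tD _; rewrite ubarE.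
  under [in RHS]eq_bigr do rewrite /= sgE.
  under [X in _ = _ + beta^-1 * X + _ + _]eq_bigr do rewrite /= sgE
    kink_rampf// mulrBr.
  rewrite sumrB.
  have -> : \sum_i l (jK i) * ((x (jK i) < T / 2)%R%:R * (t - x (jK i))) =
      (\sum_i l (jK i) * (x (jK i) < T / 2)%R%:R) * t -
      \sum_i l (jK i) * (x (jK i) < T / 2)%R%:R * x (jK i).
    by rewrite mulr_suml -sumrB; apply: eq_bigr => i _; ring.
  by ring.
- rewrite -dimY; apply: leq_trans card.
  rewrite -(cardsID [set j : bool * 'I_m | j.1]%SET [set j | (l j != 0)%R]%SET).
  apply: leq_add; apply: subset_leq_card; apply/fintype.subsetP => j;
    by rewrite !inE => /andP[-> ->].
- by rewrite TGV_eq sumE.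
Qed.
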